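(* Let $\rho^0,\rho^1$ be probability densities on $\Omega=[0,1]^d$, let $L=1+\log_2(1/h)$ be an integer, and let $h_l=2^{L-l}h$ for $l=1,\dots,L$ (so $h_1=1$, $h_L=h$). Assume: (i) the saddle-point sets $Z^*_{h_l}$ are nonempty for all $l=1,\dots,L$, and there is a constant $C_1$ independent of $h_l$ such that $\|z^*_{h_l}\|_{L^2}^2\le C_1$ for every $z^*_{h_l}=(m^*_{h_l},\phi^*_{h_l})\in Z^*_{h_l}$ with $\sum_{x\in\Omega^{h_l}}\phi^*_{h_l}(x)=0$, $l=1,\dots,L$; (ii) there are constants $C_2>0$ (independent of $h_l$) and $r>0$ such that for every $l=1,\dots,L-1$ and every $z^*_{h_l}\in Z^*_{h_l}$ there is $z^*_{h_{l+1}}\in Z^*_{h_{l+1}}$ with $\|\mathrm{Interpolate}(z^*_{h_l})-z^*_{h_{l+1}}\|_{L^2}^2\le C_2(h_l)^r$. Suppose both Algorithm 1 and Algorithm 1M are started from the zero initialization. Then: 1. If $\varepsilon\in\mathcal T_1$, the complexity of Algorithm 1 on the grid of step $h$ with tolerance $\varepsilon$ is $$\mathcal O_1=O\Big(\frac1\varepsilon\,\frac{d^{3/2}}{h^{d+1}}\Big).$$ 2. If $\{\varepsilon_l\}_{l=1}^L\in\mathcal T_{1M}$ and $\varepsilon_l=\varepsilon_L\,(h_l/h)^{\alpha}$ for $l=1,\dots,L$ with some fixed $\alpha\in\mathbb R$, the complexity of Algorithm 1M is $$\mathcal O_{1M}=\begin{cases}O\Big(\frac1{\varepsilon_L}\frac{d^{3/2}}{h^{d+1-r}}\Big)+O\Big(\frac{d2^d}{h^d}\Big),&\alpha>r-d-1,\\[1mm]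 O\Big(\frac1{\varepsilon_L}\frac{d^{3/2}}{h^{d+1-r}}\log\frac1h\Big)+O\Big(\frac{d2^d}{h^d}\Big),&\alpha=r-d-1,\\[1mm] O\Big(\frac1{\varepsilon_L}\frac{d^{3/2}}{h^{-\alpha}}\Big)+O\Big(\frac{d2^d}{h^d}\Big),&\alpha<r-d-1.\end{cases}$$
   Context: Grids and operators. $d\ge1$ is an integer, $1\le p\le\infty$. For $h>0$ with $N=1/h$ an integer, $\Omega^h=\{0,h,2h,\dots,1\}^d$. Put $\rho_h(x)=\rho^0(x)-\rho^1(x)$, $x\in\Omega^h$. For $m_h:\Omega^h\to\mathbb R^d$ with components $m_{h,i}$, $(A_hm_h)(x)=\sum_{i=1}^dD_{h,i}m_h(x)$, where, with $e_i$ the $i$-th unit vector, $D_{h,i}m_h(x)$ equals $m_{h,i}(x)/h$ if $x_i=0$; $(m_{h,i}(x)-m_{h,i}(x-he_i))/h$ if $0<x_i<1$; $-m_{h,i}(x-he_i)/h$ if $x_i=1$. $\|A_h\|$ is the operator norm for the Euclidean norms. Let $f(m_h)=\sum_{x\in\Omega^h}\|m_h(x)\|_p h^d$, $\langle\phi_h,\phi_h'\rangle_h=\sum_{x}\phi_h(x)\phi'_h(x)h^d$, $\|\phi_h\|_{L^2}^2=\sum_x\phi_h(x)^2h^d$, $\|m_h\|_{L^2}^2=\sum_x\|m_h(x)\|_2^2h^d$. For $z_h=(m_h,\phi_h)$, $\|z_h\|_{L^2}^2=\|m_h\|_{L^2}^2+\|\phi_h\|_{L^2}^2$. Saddle problem.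 $L(m_h,\phi_h)=f(m_h)+\langle\phi_h,A_hm_h-\rho_h\rangle_h$ for $m_h:\Omega^h\to\mathbb R^d$, $\phi_h:\Omega^h\to\mathbb R$; $Z_h^*$ is the set of saddle points (min over $m_h$, max over $\phi_h$) of $L$. Algorithm 1 (inputs: $h$, initial $(m_h^0,\phi_h^0)$, tolerance $\varepsilon>0$). With $\mu=\tau=1/(2\|A_h\|)$ iterate $m_h^{k+1}=\arg\min_{m_h}L(m_h,\phi_h^k)+\frac1{2\mu}\|m_h-m_h^k\|_{L^2}^2$, $\bar m_h^{k+1}=2m_h^{k+1}-m_h^k$, $\phi_h^{k+1}=\arg\max_{\phi_h}L(\bar m_h^{k+1},\phi_h)-\frac1{2\tau}\|\phi_h-\phi_h^k\|_{L^2}^2$. Let $R_h^k=\frac1\mu\|m_h^{k+1}-m_h^k\|_{L^2}^2+\frac1\tau\|\phi_h^{k+1}-\phi_h^k\|_{L^2}^2-2\langle\phi_h^{k+1}-\phi_h^k,A_h(m_h^{k+1}-m_h^k)\rangle_h$. The number of iterations $K$ is the first $k\ge0$ with $R_h^k<\varepsilon$, and the output is $z_h^K=(m_h^K,\phi_h^K)$. Interpolation from $\Omega^{h_{l-1}}$ to $\Omega^{h_l}$ ($h_{l-1}=2h_l$). For $x\in\Omega^{h_l}$ let $J$ be the set of $j$ with $x_j\in\{0,h_{l-1},2h_{l-1},\dots,1\}$ and $\hat J$ its complement in $\{1,\dots,d\}$. Let $\mathcal N(x)=\{y\in\Omega^{h_{l-1}}:y_j=x_j\ \forall j\in J,\ |y_j-x_j|\le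 h_l\ \forall j\in\hat J\}$, and for $i\in\hat J$ let $\hat{\mathcal N}_i(x)=\{y\in\mathcal N(x):y_i=x_i-h_l\}$. Then $\mathrm{Interpolate}(\phi)(x)$ is the average of $\phi$ over $\mathcal N(x)$; the $i$-th component of $\mathrm{Interpolate}(m)(x)$ is the average of $m_i$ over $\mathcal N(x)$ if $i\in J$ and over $\hat{\mathcal N}_i(x)$ if $i\in\hat J$; $\mathrm{Interpolate}(m,\phi)=(\mathrm{Interpolate}(m),\mathrm{Interpolate}(\phi))$. Algorithm 1M (inputs: $h$, $L$, tolerances $\{\varepsilon_l\}_{l=1}^L$). For $l=1,\dots,L$ run Algorithm 1 on the grid of step $h_l$ with tolerance $\varepsilon_l$, started at $0$ if $l=1$ and at $\mathrm{Interpolate}(z^{K_{l-1}}_{h_{l-1}})$ if $l\ge2$; $K_l$ is the number of iterations and $z^{K_l}_{h_l}$ the output at level $l$. Tolerance sets. $\mathcal T_1=\{\varepsilon>0:\varepsilon\le\bar\varepsilon\}$, where $\bar\varepsilon>0$ is a threshold such that Algorithm 1 (from zero) run with any $\varepsilon\le\bar\varepsilon$ outputs $z_h^K$ with $\|z_h^K-z_h^*\|_{L^2}^2\le C_2h^r$ for some $z_h^*\in Z_h^*$. $\mathcal T_{1M}$ is the set of positive sequences with $\varepsilon_1\le\bar\varepsilon_1$, $\varepsilon_2\le\bar\varepsilon_2(\varepsilon_1)$, ..., $\varepsilon_L\le\bar\varepsilon_L(\varepsilon_1,\dots,\varepsilon_{L-1})$, where $\bar\varepsilon_l(\varepsilon_1,\dots,\varepsilon_{l-1})>0$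 is a threshold such that, when Algorithm 1M is run with $\varepsilon_1,\dots,\varepsilon_{l-1}$ on levels $1,\dots,l-1$ and any $\varepsilon_l\le\bar\varepsilon_l(\varepsilon_1,\dots,\varepsilon_{l-1})$ on level $l$, one has $\|z^{K_l}_{h_l}-z^*_{h_l}\|_{L^2}^2\le C_2(h_l)^r$ for some $z^*_{h_l}\in Z^*_{h_l}$. Complexity. The complexity of Algorithm 1 is (number of iterations) $\times$ (cost of one iteration); that of Algorithm 1M is the sum of this quantity over the levels plus the cost of the interpolations between levels. Cost is the number of arithmetic operations, where evaluating the proximal (shrinkage) operator of a multiple of $\|\cdot\|_p$ at one vector of $\mathbb R^d$ costs $O(d)$ operations (the case for $p=1,2,\infty$). $O(\cdot)$ denotes the asymptotic rate as the tolerances and $h$ tend to $0$, with $d,p,\alpha,r,C_1,C_2$ fixed (the constants $C_1,C_2,r$ not depending on $h$, $l$, $L$). *)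

(* Defs.v *)
From HB Require Import structures.
From mathcomp Require Import all_boot all_order all_algebra.
From mathcomp Require Import all_classical all_reals all_analysis.

Set Implicit Arguments.
Unset Strict Implicit.
Unset Printing Implicit Defensive.

Import Order.TTheory GRing.Theory Num.Theory.

Local Open Scope classical_set_scope.
Local Open Scope ring_scope.

(* The value at [x0] is only a default, used when [F] has no minimizer. *)
Definition argmin (T : choiceType) (R : realType) (x0 : T) (F : T -> R) : T :=
  xget x0 [set x | forall y, F x <= F y].

Definition argmax (T : choiceType) (R : realType) (x0 : T) (F : T -> R) : T :=
  argmin x0 (fun x => - F x).

Section Densities.
Variable R : realType.

Definition unit_cube (d : nat) : set (d.-tuple (measurableTypeR R)) :=
  [set x | forall i, 0 <= tnth x i <= 1].

(* Integral over [0,1]^n against n-dimensional Lebesgue measure, written as an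
   iterated integral; by Tonelli this is the usual integral when the integrand
   is measurable and nonnegative. *)
Fixpoint cube_integral (n : nat) :
    (n.-tuple (measurableTypeR R) -> \bar R) -> \bar R :=
  match n with
  | 0%N => fun f => f [tuple]
  | n'.+1 => fun f => (\int[@lebesgue_measure R]_(t in `[0%R, 1%R])
      cube_integral (fun x : n'.-tuple _ => f [tuple of t :: x]))%E
  end.

Definition prob_density (d : nat) (rho : d.-tuple (measurableTypeR R) -> R) :=
  [/\ measurable_fun (@unit_cube d) rho,
      forall x, unit_cube x -> 0 <= rho x &
      cube_integral (fun x => (rho x)%:E) = 1%E].

End Densities.

(* A grid of step h = 1/N is indexed by multi-indices in {0,..,N}^d; the index
   [x] stands for the point h x. *)
Definition grid (d N : nat) := {ffun 'I_d -> 'I_N.+1}.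

(* The index of x - h e_i; meaningful when 0 < x_i. *)
Definition grid_pred (d N : nat) (x : grid d N) (i : 'I_d) : grid d N :=
  [ffun j => if j == i then inord (x j).-1 else x j].

Section Discrete.
Variables (R : realType) (d : nat).

Definition vfield (N : nat) := {ffun grid d N -> 'rV[R]_d}.
Definition sfield (N : nat) := {ffun grid d N -> R}.
Definition state (N : nat) := (vfield N * sfield N)%type.

Definition step (N : nat) : R := N%:R^-1.

Definition grid_point N (x : grid d N) : d.-tuple R :=
  [tuple (x i)%:R * step N | i < d].

Definition rho_grid (rho0 rho1 : d.-tuple R -> R) N : sfield N :=
  [ffun x => rho0 (grid_point x) - rho1 (grid_point x)].

Definition Dop N (i : 'I_d) (m : vfield N) (x : grid d N) : R :=
  if x i == 0%N :> nat then m x 0 i / step N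
  else if (x i < N)%N then (m x 0 i - m (grid_pred x i) 0 i) / step N
  else - m (grid_pred x i) 0 i / step N.

Definition Aop N (m : vfield N) : sfield N := [ffun x => \sum_i Dop i m x].

Definition l2sq_v N (m : vfield N) : R :=
  \sum_x (\sum_i m x 0 i ^+ 2) * step N ^+ d.
Definition l2sq_s N (phi : sfield N) : R := \sum_x phi x ^+ 2 * step N ^+ d.
Definition l2sq N (z : state N) : R := l2sq_v z.1 + l2sq_s z.2.
Definition inner N (phi psi : sfield N) : R :=
  \sum_x phi x * psi x * step N ^+ d.

Definition Anorm N : R :=
  sup [set Num.sqrt (\sum_x Aop m x ^+ 2) | m in
         [set m : vfield N | Num.sqrt (\sum_x \sum_i m x 0 i ^+ 2) <= 1]].

(* The exponent ranges over [1, +oo]; the value at -oo is never used. *)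
Definition lpnorm (p : \bar R) (v : 'rV[R]_d) : R :=
  match p with
  | q%:E => (\sum_i `|v 0 i| `^ q) `^ q^-1
  | +oo%E => \big[Num.max/0]_i `|v 0 i|
  | -oo%E => 0
  end.

Definition prox (p : \bar R) (lam : R) (v : 'rV[R]_d) : 'rV[R]_d :=
  argmin v (fun u => lam * lpnorm p u + 2^-1 * \sum_i (u - v) 0 i ^+ 2).

Definition objective (p : \bar R) N (m : vfield N) : R :=
  \sum_x lpnorm p (m x) * step N ^+ d.

Definition lagrangian (p : \bar R) N (rho : sfield N) (m : vfield N)
    (phi : sfield N) : R :=
  objective p m + inner phi (Aop m - rho).

Definition saddle_points (p : \bar R) N (rho : sfield N) : set (state N) :=
  [set z | forall m phi,
     lagrangian p rho z.1 phi <= lagrangian p rho z.1 z.2 /\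
     lagrangian p rho z.1 z.2 <= lagrangian p rho m z.2].

Definition stepsize N : R := (2 * Anorm N)^-1.

Definition alg1_step (p : \bar R) N (rho : sfield N) (z : state N) : state N :=
  let mu := stepsize N in let tau := stepsize N in
  let m := argmin z.1 (fun m =>
    lagrangian p rho m z.2 + (2 * mu)^-1 * l2sq_v (m - z.1)) in
  let mbar := m *+ 2 - z.1 in
  let phi := argmax z.2 (fun phi =>
    lagrangian p rho mbar phi - (2 * tau)^-1 * l2sq_s (phi - z.2)) in
  (m, phi).

(* R_h^k, as a function of two consecutive iterates *)
Definition residual N (z z' : state N) : R :=
  let mu := stepsize N in let tau := stepsize N in
  mu^-1 * l2sq_v (z'.1 - z.1) + tau^-1 * l2sq_s (z'.2 - z.2)
  - 2 * inner (z'.2 - z.2) (Aop (z'.1 - z.1)).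

Definition alg1_iter (p : \bar R) N (rho : sfield N) (z0 : state N) (k : nat) :
    state N :=
  iter k (alg1_step p rho) z0.

Definition alg1_residual (p : \bar R) N (rho : sfield N) (z0 : state N)
    (k : nat) : R :=
  residual (alg1_iter p rho z0 k) (alg1_iter p rho z0 k.+1).

Definition alg1_stops (p : \bar R) N (rho : sfield N) (z0 : state N) (eps : R)
    : set nat :=
  [set K | alg1_residual p rho z0 K < eps /\
           forall k, (k < K)%N -> eps <= alg1_residual p rho z0 k].

(* The set [alg1_stops] has at most one element. The number of iterations is
   +oo when the stopping test is never met; the output is then a default. *)
Definition alg1_niter (p : \bar R) N (rho : sfield N) (z0 : state N) (eps : R)
    : \bar R :=
  ereal_inf [set (K%:R)%:E | K in alg1_stops p rho z0 eps].

Definition alg1_output (p : \bar R) N (rho : sfield N) (z0 : state N) (eps : R)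
    : state N :=
  alg1_iter p rho z0 (xget 0%N (alg1_stops p rho z0 eps)).

(* Prolongation from N to 2N cells per direction. For a fine index [x], j is in
   the set J exactly when x_j is even; the coarse index [y] denotes the same
   point as the fine index 2y. *)
Definition neighbours N (x : grid d N.*2) : {set grid d N} :=
  [set y : grid d N | [forall j, if odd (x j)
     then (`|(y j).*2 - x j| <= 1)%N else (y j).*2 == x j]].

Definition left_neighbours N (x : grid d N.*2) (i : 'I_d) : {set grid d N} :=
  [set y in neighbours x | (y i).*2.+1 == x i].

Definition average (T : finType) (S : {set T}) (F : T -> R) : R :=
  (\sum_(y in S) F y) / #|S|%:R.

Definition interpolate_s N (phi : sfield N) : sfield N.*2 :=
  [ffun x => average (neighbours x) phi].

Definition interpolate_v N (m : vfield N) : vfield N.*2 :=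
  [ffun x : grid d N.*2 => \row_i average
     (if odd (x i) then left_neighbours x i else neighbours x)
     (fun y => m y 0 i)].

Definition interpolate N (z : state N) : state N.*2 :=
  (interpolate_v z.1, interpolate_s z.2).

End Discrete.

Section Cost.
Variables (R : realType) (d : nat) (p : \bar R) (kappa : nat).

Inductive arith := Add | Sub | Mul | Div.

Definition arith_eval (o : arith) (a b : R) : R :=
  match o with
  | Add => a + b | Sub => a - b | Mul => a * b | Div => a / b
  end.

(* [computable inp n S]: there is a straight-line program on inputs of type X
   which, given the quantities in [inp] and arbitrary real constants, makes n
   operations and after which all the quantities in S are available. An
   arithmetic operation counts for 1 and one evaluation of the proximal
   operator of a multiple of the p-norm at a vector of R^d for kappa * d. *)
Inductive computable (X : Type) (inp : set (X -> R)) :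
    nat -> set (X -> R) -> Prop :=
| computable_start : computable inp 0 (inp `|` range (fun c : R => cst c))
| computable_arith n S o f g :
    computable inp n S -> S f -> S g ->
    computable inp n.+1 (S `|` [set fun z => arith_eval o (f z) (g z)])
| computable_prox n S (lam : {nonneg R}) (v : 'I_d -> X -> R) :
    computable inp n S -> (forall i, S (v i)) ->
    computable inp (n + kappa * d)
      (S `|` range (fun i z => prox p lam%:num (\row_j v j z) 0 i)).

(* Least number of operations that produces all of [out] from [inp]. *)
Definition op_cost (X : Type) (inp out : set (X -> R)) : \bar R :=
  ereal_inf [set (n%:R)%:E | n in
    [set n | exists2 S, computable inp n S & out `<=` S]].

Definition coordinates N : set (state R d N -> R) :=
  [set F | (exists (x : grid d N) (i : 'I_d), F = fun z : state R d N => z.1 x 0 i) \/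
           (exists x : grid d N, F = fun z : state R d N => z.2 x)].

(* One iteration computes the next iterate and evaluates the quantity that is
   compared with the tolerance. *)
Definition iteration_cost N (rho : sfield R d N) : \bar R :=
  op_cost (@coordinates N)
    ([set c \o alg1_step p rho | c in @coordinates N] `|`
     [set fun z => residual z (alg1_step p rho z)]).

Definition interpolation_cost N : \bar R :=
  op_cost (@coordinates N)
    [set c \o @interpolate R d N | c in @coordinates N.*2].

Definition alg1_complexity N (rho : sfield R d N) (z0 : state R d N) (eps : R)
    : \bar R :=
  (alg1_niter p rho z0 eps * iteration_cost rho)%E.

End Cost.

(* Levels are numbered from 0: level n has 2^n cells per direction, hence step
   2^-n, and is level l = n+1 of a hierarchy numbered from 1. Finest level M
   gives L = M+1 = 1 + log_2 (1/h) levels with h = 2^-M. Written with [iter] so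
   that [cells n.+1] is convertible to [(cells n).*2]. *)
Definition cells (n : nat) : nat := iter n double 1%N.

Section Multilevel.
Variables (R : realType) (d : nat) (p : \bar R) (kappa : nat).
Variables (rho0 rho1 : d.-tuple R -> R).

Definition h_ (n : nat) : R := step R (cells n).
Definition rho_ (n : nat) : sfield R d (cells n) := rho_grid rho0 rho1 (cells n).

(* [eps`_n] is the tolerance on level n. *)
Fixpoint alg1M_start (eps : seq R) (n : nat) : state R d (cells n) :=
  match n with
  | 0%N => 0
  | n'.+1 => interpolate
      (alg1_output p (rho_ n') (alg1M_start eps n') eps`_n')
  end.

Definition alg1M_output (eps : seq R) (n : nat) : state R d (cells n) :=
  alg1_output p (rho_ n) (alg1M_start eps n) eps`_n.

Definition alg1M_complexity (M : nat) (eps : seq R) : \bar R :=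
  (\sum_(n < M.+1)
      alg1_complexity p kappa (rho_ n) (alg1M_start eps n) eps`_n
   + \sum_(n < M) interpolation_cost d p kappa (cells n))%E.

(* A state at level n is accurate if it is C2 h_n^r close to a saddle point. *)
Definition accurate (C2 r : R) (n : nat) (z : state R d (cells n)) : Prop :=
  exists2 zs, saddle_points p (rho_ n) zs & l2sq (z - zs) <= C2 * h_ n `^ r.

Definition threshold1 (C2 r : R) (n : nat) (ebar : R) : Prop :=
  0 < ebar /\ forall eps, 0 < eps <= ebar ->
    accurate C2 r (alg1_output p (rho_ n) 0 eps).

Definition T1 (ebar : R) : set R := [set eps | 0 < eps <= ebar].

(* [ebar [:: e_0; ..; e_(n-1)]] is the threshold on level n once the tolerances
   on the coarser levels have been chosen. *)
Definition admissible (ebar : seq R -> R) (eps : seq R) : Prop :=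
  forall n, (n < size eps)%N -> 0 < eps`_n <= ebar (take n eps).

Definition threshold1M (C2 r : R) (M : nat) (ebar : seq R -> R) : Prop :=
  forall s : seq R, (size s <= M)%N -> admissible ebar s ->
    0 < ebar s /\ forall e, 0 < e <= ebar s ->
      accurate C2 r (alg1M_output (rcons s e) (size s)).

Definition T1M (M : nat) (ebar : seq R -> R) : set (seq R) :=
  [set eps | size eps = M.+1 /\ admissible ebar eps].

Definition bounded_saddle_points (C1 : R) (n : nat) : Prop :=
  saddle_points p (rho_ n) !=set0 /\
  forall zs, saddle_points p (rho_ n) zs -> \sum_x zs.2 x = 0 -> l2sq zs <= C1.

Definition interpolation_accurate (C2 r : R) (n : nat) : Prop :=
  forall zs, saddle_points p (rho_ n) zs ->
    exists2 zs', saddle_points p (rho_ n.+1) zs' &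
      l2sq ((interpolate zs : state R d (cells n.+1)) - zs') <= C2 * h_ n `^ r.

End Multilevel.

(* Main.v *)
(* One step of Algorithm 1 is a proximal-point step for the quadratic form
   Q(z) = (1/mu) |m|^2 + (1/tau) |phi|^2 - 2 <phi, A m>, which is nonnegative and
   at most 3 ||A|| |z|^2 for mu = tau = 1/(2 ||A||): for every saddle point zs,
   Q(z' - zs) + Q(z' - z) <= Q(z - zs), and Q(z' - z) is the residual. Summing
   over the iterations, a run started at z0 makes at most
   3 ||A|| |z0 - zs|^2 / eps iterations, with ||A|| <= 2 sqrt d / h, at a cost of
   O(h^-d) operations each. From zero, zs can be shifted to have mean zero, so
   that |z0 - zs|^2 <= C1. On a level n > 0 of Algorithm 1M, the interpolation is
   bounded in L^2 and the previous output is accurate, so |z0 - zs|^2 = O(h_n^r);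
   level n then costs O(h_n^(r - d - 1) / eps_n), and summing over the levels is a
   geometric progression whose ratio is 2^(alpha + d + 1 - r). *)
Require Import Defs.
From mathcomp Require Import all_boot all_order all_algebra.
From mathcomp Require Import all_classical all_reals all_analysis.
From mathcomp Require Import ring lra zify.

Import Order.TTheory GRing.Theory Num.Theory.
Import numFieldTopology.Exports numFieldNormedType.Exports.

Local Open Scope classical_set_scope.
Local Open Scope ring_scope.

(** * The p-norm and its proximal operator *)


(** [argmin] is a choice with a default value, so nothing can be said about an iterate before its
    two subproblems are shown to have exactly one solution each. Solving them gives a closed form of
    the step: a proximal map at every grid point, then an explicit update of phi. The descent
    inequality and the operation count both start from this form. For an arbitrary p in [1, +oo]
    there is no formula for the proximal map; all that is used of it is a variational inequality,
    obtained from Minkowski's inequality and compactness. The number of iterations is an infimum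
    that would be +oo for a run that never stops, so the bound on the summed residuals has to yield
    termination as well. The cost is a least operation count, hence exhibiting one program bounds
    it. The descent inequality holds for every saddle point. Each run may therefore be compared with
    its own: a centered one on the coarsest level, elsewhere the one that the interpolation
    hypothesis attaches to a saddle point near the previous output. Uniqueness of saddle points
    never enters. *)

Lemma xget_unique {T : choiceType} (x0 a : T) (P : set T) :
  P a -> (forall b, P b -> b = a) -> xget x0 P = a.
Proof. by move=> Pa uniq_a; apply: uniq_a; exact: xgetPex (ex_intro _ a Pa). Qed.

Section ContinuousReal.
Context {R : realType} {T : topologicalType}.
Implicit Types f g : T -> R.

Lemma continuous_sumr {I : Type} (r : seq I) (F : I -> T -> R) :
  (forall i, continuous (F i)) -> continuous (fun x => \sum_(i <- r) F i x).
Proof.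
move=> fa x; elim: r => [|i r IH].
  by under eq_fun do rewrite big_nil; exact: cvg_cst.
rewrite /continuous_at big_cons.
by under eq_fun do rewrite big_cons; apply: cvgD => //; exact: fa.
Qed.

Lemma continuous_lincomb (a b : R) f g : continuous f -> continuous g ->
  continuous (fun x => a * f x + b * g x).
Proof. by move=> cf cg x; apply: cvgD; apply: cvgMl_tmp; [exact: cf|exact: cg]. Qed.

Lemma continuous_sqr_sub (c : R) f : continuous f ->
  continuous (fun x => (f x - c) ^+ 2).
Proof.
move=> cf x; rewrite /continuous_at expr2; under eq_fun do rewrite expr2.
by apply: cvgM; apply: cvgB; (exact: cf || exact: cvg_cst).
Qed.

End ContinuousReal.

Lemma lipschitz_continuous {R : realType} {V : normedModType R} (f : V -> R) (K : R) :
  0 < K -> (forall u v, `|f u - f v| <= K * `|u - v|) -> continuous f.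
Proof.
move=> K0 lip x; apply/cvgrPdist_le => e e0; near=> y.
rewrite (le_trans (lip _ _))// mulrC -ler_pdivlMr//.
near: y; apply: (@cvgr_dist_le _ _ _ (nbhs x) _ id x); first exact: cvg_id.
by rewrite divr_gt0.
Unshelve. all: by end_near.
Qed.

Section LpNorm.
Context {R : realType} {d : nat}.
Implicit Types (p : \bar R) (u v w : 'rV[R]_d).

Lemma lpnorm_ge0 p v : 0 <= lpnorm p v.
Proof.
case: p => [q| |] //=; first exact: powR_ge0.
exact: bigmax_ge_id.
Qed.

Lemma lpnormZ p (c : R) v : (1 <= p)%E -> lpnorm p (c *: v) = `|c| * lpnorm p v.
Proof.
case: p => [q| |] //=.
- rewrite lee_fin => q1; have q0 : q != 0 by rewrite gt_eqF// (lt_le_trans _ q1).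
  under eq_bigr do rewrite mxE normrM powRM//.
  rewrite -mulr_sumr powRM ?powR_ge0//; last first.
    by apply: sumr_ge0 => i _; exact: powR_ge0.
  by rewrite -powRrM mulfV// powRr1.
- move=> _; under eq_bigr do rewrite mxE normrM.
  elim/big_ind2: _ => [|a a' b b' -> ->|//]; first by rewrite mulr0.
  by rewrite maxr_pMr.
Qed.

(** Minkowski's inequality from the convexity of x^q. With a and b the norms of u and v, (|u_i| +
    |v_i|) / (a + b) is the convex combination of |u_i| / a and |v_i| / b with weights a / (a + b)
    and b / (a + b), and the q-th powers of these two sum to 1 over i. The cases u = 0 and v = 0 are
    set apart because of the divisions. *)
Lemma lpnormD p u v : (1 <= p)%E -> lpnorm p (u + v) <= lpnorm p u + lpnorm p v.
Proof.
case: p => [q| |] //=; last first.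
  move=> _; apply/bigmax_leP; split; first by rewrite addr_ge0 ?bigmax_ge_id.
  move=> i _; rewrite mxE (le_trans (ler_normD _ _))// lerD//; exact: le_bigmax.
rewrite lee_fin => q1; have q0 : 0 < q by rewrite (lt_le_trans _ q1).
pose S w := \sum_i `|w 0 i| `^ q.
have S0 w : 0 <= S w by apply: sumr_ge0 => i _; exact: powR_ge0.
rewrite -/(S u) -/(S v) -/(S (u + v)).
have eq0 w : S w = 0 -> w = 0.
  move=> /eqP; rewrite psumr_eq0; last by move=> i _; exact: powR_ge0.
  move=> /allP w0; apply/rowP => i; rewrite mxE; apply/eqP.
  have := w0 i; rewrite mem_index_enum powR_eq0 => /(_ isT)/=.
  by rewrite normr_eq0 => /andP[].
have S00 : S 0 `^ q^-1 = 0.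
  rewrite /S big1 ?powR0 ?invr_eq0 ?gt_eqF// => i _.
  by rewrite mxE normr0 powR0// gt_eqF.
have [Su|Su] := eqVneq (S u) 0.
  by rewrite (eq0 _ Su) add0r S00 add0r.
have [Sv|Sv] := eqVneq (S v) 0.
  by rewrite (eq0 _ Sv) addr0 S00 addr0.
set a := S u `^ q^-1; set b := S v `^ q^-1.
have a0 : 0 < a by rewrite powR_gt0// lt0r Su S0.
have b0 : 0 < b by rewrite powR_gt0// lt0r Sv S0.
have aq : a `^ q = S u by rewrite -powRrM mulVf ?gt_eqF// powRr1.
have bq : b `^ q = S v by rewrite -powRrM mulVf ?gt_eqF// powRr1.
clearbody a b.
have ab0 : 0 < a + b by rewrite addr_gt0.
suff le1 : S (u + v) <= (a + b) `^ q.
  have -> : a + b = ((a + b) `^ q) `^ q^-1.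
    by rewrite -powRrM mulfV ?gt_eqF// powRr1// ltW.
  by apply: ge0_ler_powR; rewrite ?nnegrE ?invr_ge0 ?powR_ge0 ?S0 ?(ltW q0).
pose t := a / (a + b); have t0 : 0 <= t by rewrite divr_ge0// ltW.
have t1 : t <= 1 by rewrite ler_pdivrMr// mul1r lerDl ltW.
have tE : 1 - t = b / (a + b) by rewrite /t; field; rewrite gt_eqF.
have convq (x y : R) : 0 <= x -> 0 <= y ->
    (t * x + (1 - t) * y) `^ q <= t * x `^ q + (1 - t) * y `^ q.
  move=> x0 y0; apply: (convex_powR q1 (Itv01 t0 t1)).
    by rewrite inE/= in_itv/= x0.
  by rewrite inE/= in_itv/= y0.
have powR_div (x c : R) : 0 <= x -> 0 < c -> (x / c) `^ q = x `^ q / c `^ q.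
  move=> x0 c0; rewrite powRM// ?invr_ge0 ?ltW//.
  by rewrite -powR_inv1 ?ltW// -powRrM mulN1r powRN.
have termle i : `|(u + v) 0 i| `^ q <=
    (a + b) `^ q * (t * (`|u 0 i| `^ q / S u) + (1 - t) * (`|v 0 i| `^ q / S v)).
  apply: (@le_trans _ _ ((a + b) `^ q *
     (t * (`|u 0 i| / a) `^ q + (1 - t) * (`|v 0 i| / b) `^ q))); last first.
    by rewrite !powR_div// aq bq.
  have ua0 : 0 <= `|u 0 i| / a by rewrite divr_ge0// ltW.
  have vb0 : 0 <= `|v 0 i| / b by rewrite divr_ge0// ltW.
  apply: le_trans (ler_wpM2l (powR_ge0 _ _) (convq _ _ ua0 vb0)).
  have comb0 : 0 <= t * (`|u 0 i| / a) + (1 - t) * (`|v 0 i| / b).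
    by rewrite addr_ge0// mulr_ge0// subr_ge0.
  rewrite -powRM ?(ltW ab0)//.
  apply: ge0_ler_powR; rewrite ?nnegrE ?(ltW q0) ?mulr_ge0 ?(ltW ab0)//.
  rewrite mxE (le_trans (ler_normD _ _))// tE /t le_eqVlt; apply/orP; left.
  by apply/eqP; field; rewrite !gt_eqF.
rewrite (le_trans (ler_sum _ (fun i _ => termle i)))// -mulr_sumr.
rewrite big_split/= -!mulr_sumr -!mulr_suml -/(S u) -/(S v) !divff//.
by rewrite !mulr1 subrKC mulr1.
Qed.

(** Expanding u in the unit vectors bounds its p-norm by a multiple of the sup norm. The resulting
    continuity feeds the extreme value theorem below. *)
Lemma lpnorm_lipschitz p : (1 <= p)%E ->
  exists2 K : R, 0 < K & forall u v, `|lpnorm p u - lpnorm p v| <= K * `|u - v|.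
Proof.
move=> p1; pose K : R := \sum_(i < d) lpnorm p (delta_mx 0 i).
have K0 : 0 <= K by apply: sumr_ge0 => i _; exact: lpnorm_ge0.
have lpnorm_le u : lpnorm p u <= K * `|u|.
  rewrite [in leLHS](row_sum_delta u) mulr_suml.
  elim/big_ind2: _ => [|x x' y y' xx' yy'|i _].
  - by rewrite -(scale0r 0) lpnormZ// normr0 mul0r.
  - by rewrite (le_trans (lpnormD _ _ _ p1))// lerD.
  rewrite lpnormZ// mulrC ler_wpM2l ?lpnorm_ge0//.
  rewrite [leRHS](_ : _ = mx_norm u)// mx_normrE.
  exact: (le_bigmax _ (fun ij : 'I_1 * 'I_d => `|u ij.1 ij.2|) (0, i)).
exists (K + 1); first by rewrite ltr_wpDl.
have half u v : lpnorm p u - lpnorm p v <= (K + 1) * `|u - v|.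
  rewrite lerBlDr -{1}(subrK v u) (le_trans (lpnormD _ _ _ p1))// lerD//.
  by rewrite (le_trans (lpnorm_le _))// ler_wpM2r// lerDl.
by move=> u v; rewrite ler_norml lerNl opprB half distrC half.
Qed.

Definition prox_objective p (lam : R) v u : R :=
  lam * lpnorm p u + 2^-1 * \sum_i (u - v) 0 i ^+ 2.

Lemma lpnorm_continuous p : (1 <= p)%E -> continuous (@lpnorm R d p).
Proof.
move=> p1; have [K K0 lip] := lpnorm_lipschitz p p1.
exact: (@lipschitz_continuous R 'rV[R]_d (lpnorm p) K).
Qed.

Lemma prox_objective_continuous p lam v : (1 <= p)%E ->
  continuous (prox_objective p lam v).
Proof.
move=> p1; have := @continuous_lincomb R 'rV[R]_d lam 2^-1 (lpnorm p)
  (fun u => \sum_i (u - v) 0 i ^+ 2) (lpnorm_continuous p p1).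
apply; under eq_fun do under eq_bigr do rewrite 2!mxE.
by apply: continuous_sumr => i; apply: continuous_sqr_sub; exact: coord_continuous.
Qed.

Lemma prox_objective_has_min p lam v : (1 <= p)%E -> 0 <= lam ->
  exists u, forall w, prox_objective p lam v u <= prox_objective p lam v w.
Proof.
move=> p1 lam0.
(* Outside the box of half-width B around v, the quadratic term alone is at least B^2 / 2 >= B / 2
   >= lam ||v||_p, the value of the objective at v. Minimizing over the compact box is therefore
   enough. *)
pose B : R := 1 + 2 * (lam * lpnorm p v).
have B1 : 1 <= B by rewrite lerDl !mulr_ge0// lpnorm_ge0.
pose box := [set u : 'rV[R]_d | forall i, `[v 0 i - B, v 0 i + B]%classic (u ord0 i)].
have boxv : box v.
  by move=> i; rewrite /= in_itv/= lerBlDr !lerDl (le_trans _ B1).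
have cbox : compact box.
  by apply: (@rV_compact _ _ (fun i => `[v 0 i - B, v 0 i + B]%classic)) => i;
    exact: segment_compact.
have [||c _ cmin] := @EVT_min_rV _ _ (prox_objective p lam v) box _ cbox.
- by exists v.
- by apply: continuous_subspaceT; exact: prox_objective_continuous.
exists c => w; have [bw|nbw] := pselect (box w); first by apply: cmin; rewrite inE.
apply: (@le_trans _ _ (prox_objective p lam v v)); first by apply: cmin; rewrite inE.
move/existsNP: nbw => [i wi].
rewrite /prox_objective subrr [X in 2^-1 * X]big1 ?mulr0 ?addr0; last first.
  by move=> j _; rewrite mxE expr0n.
rewrite -[leLHS]add0r lerD ?mulr_ge0 ?lpnorm_ge0//.
rewrite (bigD1 i)//= mulrDr -[leLHS]addr0 lerD//; last first.
  by rewrite mulr_ge0 ?invr_ge0// sumr_ge0// => j _; rewrite sqr_ge0.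
have B2 : B <= `|w 0 i - v 0 i|.
  rewrite leNgt; apply/negP => /ltW; rewrite ler_norml => /andP[h1 h2].
  by apply: wi; rewrite /= in_itv/=; apply/andP; split; lra.
rewrite !mxE -real_normK ?num_real//.
have h1 : `|w 0 i - v 0 i| <= `|w 0 i - v 0 i| ^+ 2.
  by rewrite ler_eXnr// (le_trans B1).
have h2 : B = 1 + 2 * (lam * lpnorm p v) by [].
by clearbody B; lra.
Qed.

Lemma linear_coef_ge0 (a b : R) :
  (forall t, 0 < t <= 1 -> 0 <= t * a + t ^+ 2 * b) -> 0 <= a.
Proof.
move=> H; rewrite leNgt; apply/negP => a0.
(* Replaces the limit t -> 0: for a < 0 this t satisfies t |b| < - a, so a + t b < 0. *)
pose t := - a / (- a + 1 + `|b|).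
have D0 : 0 < - a + 1 + `|b| by rewrite ltr_pwDl// addr_gt0// oppr_gt0.
have t0 : 0 < t by rewrite divr_gt0 ?oppr_gt0.
have t1 : t <= 1 by rewrite ler_pdivrMr// mul1r -addrA lerDl addr_ge0.
have := H t; rewrite t0 t1 => /(_ isT).
rewrite expr2 -mulrA -mulrDr pmulr_rge0// => H1.
have : t * b <= t * `|b| by rewrite ler_pM2l// ler_norm.
have : t * (- a + 1 + `|b|) = - a by rewrite divfK// gt_eqF.
by nra.
Qed.

(** The conclusion says that v - u is a subgradient of lam ||.||_p at u. The norm need not be
    differentiable: u is compared with u + t (w - u), convexity makes the change of the norm at most
    linear in t, and the coefficient of t in the total must be nonnegative. *)
Lemma prox_variational p lam v u : (1 <= p)%E -> 0 <= lam ->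
  (forall w, prox_objective p lam v u <= prox_objective p lam v w) ->
  forall w, lam * lpnorm p u + \sum_i (v 0 i - u 0 i) * (w 0 i - u 0 i)
            <= lam * lpnorm p w.
Proof.
move=> p1 lam0 umin w; rewrite -subr_ge0.
apply: (@linear_coef_ge0 _ (2^-1 * \sum_i (w 0 i - u 0 i) ^+ 2)) => t /andP[t0 t1].
have := umin (u + t *: (w - u)); rewrite /prox_objective.
have lpt : lpnorm p (u + t *: (w - u)) <= (1 - t) * lpnorm p u + t * lpnorm p w.
  have -> : u + t *: (w - u) = (1 - t) *: u + t *: w.
    by rewrite scalerBr scalerBl scale1r addrA addrAC.
  rewrite (le_trans (lpnormD _ _ _ p1))// !lpnormZ//.
  by rewrite !ger0_norm// ?subr_ge0// ltW.
have -> : \sum_i (u + t *: (w - u) - v) 0 i ^+ 2 = \sum_i (u - v) 0 i ^+ 2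
    - 2 * t * (\sum_i (v 0 i - u 0 i) * (w 0 i - u 0 i))
    + t ^+ 2 * \sum_i (w 0 i - u 0 i) ^+ 2.
  rewrite !mulr_sumr -sumrB -big_split/=; apply: eq_bigr => i _.
  by rewrite !mxE; ring.
have := ler_wpM2l lam0 lpt.
set P := \sum_i _ ^+ 2; set Q := \sum_i _ * _; set S := \sum_i _ ^+ 2.
by lra.
Qed.

Lemma prox_optimality p lam v : (1 <= p)%E -> 0 <= lam -> forall w,
  lam * lpnorm p (prox p lam v)
    + \sum_i (v 0 i - prox p lam v 0 i) * (w 0 i - prox p lam v 0 i)
  <= lam * lpnorm p w.
Proof.
move=> p1 lam0; apply: prox_variational => //.
exact: (xgetPex v (prox_objective_has_min p lam v p1 lam0)).
Qed.

End LpNorm.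

(** * The discrete divergence and its adjoint *)


(** Cauchy-Schwarz against the constant 1, read off from the nonnegative sum of (a_i - a_j)^2 over
    all pairs. *)
Lemma sqr_sum_le {R : realDomainType} {I : finType} (A : {pred I}) (a : I -> R) :
  (\sum_(i in A) a i) ^+ 2 <= #|A|%:R * \sum_(i in A) a i ^+ 2.
Proof.
set S := \sum_(i in A) a i; set Q := \sum_(i in A) a i ^+ 2.
have sum_j i : \sum_(j in A) (a i - a j) ^+ 2
    = #|A|%:R * a i ^+ 2 - 2 * S * a i + Q.
  rewrite (eq_bigr (fun j => a i ^+ 2 - 2 * a i * a j + a j ^+ 2)); last first.
    by move=> j _; ring.
  by rewrite big_split sumrB/= sumr_const -mulr_sumr -/S -/Q -mulr_natl; ring.
have : 0 <= \sum_(i in A) \sum_(j in A) (a i - a j) ^+ 2.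
  by do 2!apply: sumr_ge0 => ? _; exact: sqr_ge0.
under eq_bigr do rewrite sum_j.
by rewrite big_split sumrB/= sumr_const -!mulr_sumr -/S -/Q -mulr_natl; lra.
Qed.

Section Grid.
Context {R : realType} {d N : nat}.
Context (N_gt0 : (0 < N)%N).
Implicit Types (x y : grid d N) (i : 'I_d).

Definition grid_succ x i : grid d N :=
  [ffun j => if j == i then inord (x j).+1 else x j].

Lemma grid_predK x i : (0 < x i)%N -> grid_succ (grid_pred x i) i = x.
Proof.
move=> x0; apply/ffunP => j; rewrite !ffunE; case: eqVneq => // ->.
rewrite inordK ?prednK ?inord_val//.
by rewrite ltnW.
Qed.

(** Beyond the last index [inord] falls back to 0, which makes the equality hold on the upper face
    too. *)
Lemma grid_succ_gt0 x i : (0 < grid_succ x i i)%N = (x i < N)%N.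
Proof.
rewrite ffunE eqxx; have [xN|xN] := ltnP (x i) N; first by rewrite inordK.
rewrite /inord /insubd insubF//=.
by apply/negbTE; rewrite -leqNgt ltnS.
Qed.

Lemma grid_succK x i : (x i < N)%N -> grid_pred (grid_succ x i) i = x.
Proof.
move=> xN; apply/ffunP => j; rewrite !ffunE; case: eqVneq => // ->.
by rewrite inordK ?ltnS// inord_val.
Qed.

Lemma sum_grid_shift (V : nmodType) i (F : grid d N -> grid d N -> V) :
  \sum_(x : grid d N | (0 < x i)%N) F x (grid_pred x i)
  = \sum_(x : grid d N | (x i < N)%N) F (grid_succ x i) x.
Proof.
rewrite (reindex_onto (fun y => grid_succ y i) (fun x => grid_pred x i)); last first.
  by move=> x x0; exact: grid_predK.
apply: eq_big => [x|x /andP[_ /eqP->]]//.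
rewrite grid_succ_gt0; have [xN|//] := boolP (_ < _)%N.
by rewrite grid_succK// eqxx.
Qed.

Local Notation vfield := (vfield R d N).
Local Notation sfield := (sfield R d N).
Implicit Types (m : vfield) (phi psi : sfield).

Lemma invr_step : (step R N)^-1 = N%:R.
Proof. by rewrite invrK. Qed.

Lemma step_gt0 : 0 < step R N.
Proof. by rewrite invr_gt0 ltr0n. Qed.

Lemma stepX_gt0 : 0 < step R N ^+ d.
Proof. by rewrite exprn_gt0// step_gt0. Qed.

(** Splits the three boundary cases into two terms with separate indicators, so that each can be
    shifted on its own in a summation by parts. Since N > 0, no point lies on both faces at once. *)
Lemma DopE i m x : Dop i m x =
  N%:R * ((if (x i < N)%N then m x 0 i else 0)
          - (if (0 < x i)%N then m (grid_pred x i) 0 i else 0)).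
Proof.
rewrite /Dop invr_step mulrC lt0n; case: ifPn => [/eqP->|x0].
  by rewrite N_gt0 subr0 mulrC mulrC.
by case: ifPn => _; rewrite 1?mulrC ?sub0r// mulrC.
Qed.

(** The adjoint of [Aop]: minus the forward difference, and 0 on the face x_i = N, where m_i does
    not enter [Aop]. *)
Definition adjoint phi : vfield :=
  [ffun x : grid d N => \row_i (N%:R * (if (x i < N)%N then phi x - phi (grid_succ x i) else 0))].

Definition vinner m m' : R :=
  \sum_x (\sum_i m x 0 i * m' x 0 i) * step R N ^+ d.

Lemma inner_Aop phi m : inner phi (Aop m) = vinner (adjoint phi) m.
Proof.
rewrite /inner /vinner -!mulr_suml; congr (_ * _).
under eq_bigr do rewrite ffunE mulr_sumr.
rewrite exchange_big [RHS]exchange_big/=; apply: eq_bigr => i _.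
under eq_bigr do rewrite DopE mulrCA mulrBr.
under [RHS]eq_bigr do rewrite ffunE mxE -mulrA.
rewrite -!mulr_sumr; congr (_ * _); rewrite sumrB.
have -> : \sum_x phi x * (if (0 < x i)%N then m (grid_pred x i) 0 i else 0)
    = \sum_(x : grid d N | (x i < N)%N) phi (grid_succ x i) * m x 0 i.
  rewrite -(sum_grid_shift _ i (fun x y => phi x * m y 0 i)) [RHS]big_mkcond/=.
  by apply: eq_bigr => x _; case: ifP; rewrite ?mulr0.
rewrite [X in _ - X]big_mkcond -sumrB; apply: eq_bigr => x _.
by case: ifP; rewrite ?mulr0 ?mul0r ?subr0// mulrBl.
Qed.

Lemma sum_Aop m : \sum_x Aop m x = 0.
Proof.
under eq_bigr do rewrite ffunE.
rewrite exchange_big big1// => i _.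
under eq_bigr do rewrite DopE.
rewrite -mulr_sumr sumrB -[X in _ - X]big_mkcond/=.
by rewrite (sum_grid_shift _ i (fun x y => m y 0 i)) -big_mkcond subrr mulr0.
Qed.

Lemma AopB m m' : Aop (m - m') = Aop m - Aop m'.
Proof.
apply/ffunP => x; rewrite !ffunE -sumrB; apply: eq_bigr => i _.
rewrite !DopE -mulrBr; congr (_ * _).
by case: ifP => _; case: ifP => _; rewrite ?ffunE ?mxE; ring.
Qed.

Lemma AopZ (c : R) m : Aop (c *: m) = c *: Aop m.
Proof.
apply/ffunP => x; rewrite !ffunE scaler_sumr; apply: eq_bigr => i _.
rewrite -[RHS]/(c * _) !DopE [RHS]mulrCA; congr (_ * _).
by case: ifP => _; case: ifP => _; rewrite ?ffunE ?mxE; ring.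
Qed.

Definition euclid_v m : R := \sum_x \sum_i m x 0 i ^+ 2.
Definition euclid_s phi : R := \sum_x phi x ^+ 2.

Lemma euclid_v_ge0 m : 0 <= euclid_v m.
Proof. by do 2!apply: sumr_ge0 => ? _; exact: sqr_ge0. Qed.

Lemma euclid_s_ge0 phi : 0 <= euclid_s phi.
Proof. by apply: sumr_ge0 => ? _; exact: sqr_ge0. Qed.

(** The factor d comes from Cauchy-Schwarz over the directions, and 4 = 2 * 2 from (a - b)^2 <= 2
    (a^2 + b^2) and from each value of m_i occurring in at most two differences. *)
Lemma euclid_Aop_le m : euclid_s (Aop m) <= 4 * d%:R * N%:R ^+ 2 * euclid_v m.
Proof.
apply: (@le_trans _ _ (\sum_x d%:R * \sum_i Dop i m x ^+ 2)).
  apply: ler_sum => x _; rewrite ffunE.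
  have := @sqr_sum_le R 'I_d predT (fun i => Dop i m x).
  by rewrite (_ : #|_| = d)//; exact: card_ord.
rewrite -mulr_sumr.
have -> : 4 * d%:R * N%:R ^+ 2 * euclid_v m
  = d%:R * (N%:R ^+ 2 * (2 * (2 * euclid_v m))) by ring.
rewrite ler_wpM2l// exchange_big/= /euclid_v [X in _ <= _ * (_ * (_ * X))]exchange_big/=.
rewrite !mulr_sumr; apply: ler_sum => i _.
apply: (@le_trans _ _ (\sum_(x : grid d N) N%:R ^+ 2 * (2 *
   ((if (x i < N)%N then m x 0 i ^+ 2 else 0)
     + (if (0 < x i)%N then m (grid_pred x i) 0 i ^+ 2 else 0))))).
  apply: ler_sum => x _; rewrite DopE exprMn ler_wpM2l ?sqr_ge0//.
  have sqrB_le (a b : R) : (a - b) ^+ 2 <= 2 * (a ^+ 2 + b ^+ 2).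
    by have := sqr_ge0 (a + b); rewrite sqrrD sqrrB; lra.
  by have := sqrB_le (if (x i < N)%N then m x 0 i else 0)
    (if (0 < x i)%N then m (grid_pred x i) 0 i else 0);
    do 2!case: ifP => _; rewrite ?expr0n.
rewrite -!mulr_sumr ler_wpM2l ?sqr_ge0// ler_wpM2l// big_split/= -!big_mkcond/=.
rewrite (sum_grid_shift _ i (fun x y => m y 0 i ^+ 2)) mulr_natl mulr2n.
by rewrite lerD// big_mkcond; apply: ler_sum => x _; case: ifP; rewrite ?sqr_ge0.
Qed.

Lemma Anorm_ubound : ubound
  [set Num.sqrt (euclid_s (Aop m)) | m in [set m | Num.sqrt (euclid_v m) <= 1]]
  (2 * Num.sqrt d%:R * N%:R).
Proof.
move=> _ [m /= m1 <-].
have -> : 2 * Num.sqrt d%:R * N%:R = Num.sqrt (4 * d%:R * N%:R ^+ 2) :> R.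
  rewrite sqrtrM ?mulr_ge0// sqrtr_sqr ger0_norm// sqrtrM//; congr (_ * _ * _).
  by rewrite -[4]/(2 * 2)%:R natrM -expr2 sqrtr_sqr ger0_norm.
rewrite ler_wsqrtr// (le_trans (euclid_Aop_le m))// ler_piMr ?mulr_ge0 ?sqr_ge0//.
by rewrite -sqrtr1 ler_sqrt in m1.
Qed.

Lemma Anorm_le : Anorm R d N <= 2 * Num.sqrt d%:R * N%:R.
Proof.
apply: ge_sup Anorm_ubound.
by exists (Num.sqrt (euclid_s (Aop 0))), 0 => //=; rewrite /euclid_v big1 ?sqrtr0// =>
  x _; rewrite big1// => i _; rewrite ffunE mxE expr0n.
Qed.

Lemma Anorm_has_sup : has_sup
  [set Num.sqrt (euclid_s (Aop m)) | m in [set m | Num.sqrt (euclid_v m) <= 1]].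
Proof.
split; last by exists (2 * Num.sqrt d%:R * N%:R); exact: Anorm_ubound.
by exists (Num.sqrt (euclid_s (Aop 0))), 0 => //=; rewrite /euclid_v big1 ?sqrtr0// =>
  x _; rewrite big1// => i _; rewrite ffunE mxE expr0n.
Qed.

Lemma sqrt_euclid_Aop_le m :
  Num.sqrt (euclid_s (Aop m)) <= Anorm R d N * Num.sqrt (euclid_v m).
Proof.
have [m0|m0] := eqVneq (euclid_v m) 0.
  have := euclid_Aop_le m; rewrite m0 mulr0 => ms.
  by rewrite sqrtr0 mulr0 ler0_sqrtr.
set c := Num.sqrt (euclid_v m).
have c0 : 0 < c by rewrite sqrtr_gt0 lt0r m0 euclid_v_ge0.
have vZ : euclid_v (c^-1 *: m) = 1.
  rewrite /euclid_v; under eq_bigr => x _ do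
    under eq_bigr => i _ do rewrite ffunE mxE exprMn.
  under eq_bigr do rewrite -mulr_sumr.
  rewrite -mulr_sumr exprVn sqr_sqrtr ?euclid_v_ge0// mulVf//.
have sZ : euclid_s (Aop (c^-1 *: m)) = (c^-1) ^+ 2 * euclid_s (Aop m).
  rewrite AopZ /euclid_s mulr_sumr; apply: eq_bigr => x _.
  by rewrite ffunE -[_ *: _]/(_ * _) exprMn.
have := @sup_ubound _ _ (proj2 Anorm_has_sup) (Num.sqrt (euclid_s (Aop (c^-1 *: m)))).
rewrite sZ sqrtrM ?sqr_ge0// sqrtr_sqr ger0_norm ?invr_ge0 ?(ltW c0)//.
rewrite mulrC ler_pdivrMr//; apply.
by exists (c^-1 *: m) => /=; rewrite ?vZ ?sqrtr1// sZ sqrtrM ?sqr_ge0// sqrtr_sqr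
  ger0_norm ?invr_ge0 ?(ltW c0)// mulrC.
Qed.

Lemma Anorm_ge0 : 0 <= Anorm R d N.
Proof.
have := @sup_ubound _ _ (proj2 Anorm_has_sup) (Num.sqrt (euclid_s (Aop 0))).
move=> /(_ _)/(le_trans (sqrtr_ge0 _)); apply.
by exists 0 => //=; rewrite /euclid_v big1 ?sqrtr0// =>
  x _; rewrite big1// => i _; rewrite ffunE mxE expr0n.
Qed.

Lemma euclid_Aop_le_Anorm m : euclid_s (Aop m) <= Anorm R d N ^+ 2 * euclid_v m.
Proof.
have := sqrt_euclid_Aop_le m.
rewrite -(@ler_pXn2r _ 2) ?nnegrE ?mulr_ge0 ?sqrtr_ge0 ?Anorm_ge0//.
by rewrite exprMn !sqr_sqrtr ?euclid_v_ge0 ?euclid_s_ge0.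
Qed.

Lemma Anorm_gt0 : (0 < d)%N -> 0 < Anorm R d N.
Proof.
move=> d0; rewrite lt0r Anorm_ge0 andbT; apply/eqP => A0.
(* The constant field 1 has divergence d N at the corner 0. *)
have := euclid_Aop_le_Anorm [ffun=> const_mx 1].
rewrite A0 expr0n mul0r leNgt => /negP; apply.
rewrite /euclid_s (bigD1 [ffun=> ord0])//= ltr_pwDl//; last first.
  by apply: sumr_ge0 => x _; exact: sqr_ge0.
rewrite exprn_gt0// ffunE (eq_bigr (fun=> N%:R)); last first.
  by move=> i _; rewrite DopE !ffunE/= N_gt0 mxE subr0 mulr1.
by rewrite sumr_const card_ord -mulrnA ltr0n muln_gt0 N_gt0.
Qed.

Lemma l2sq_vE m : l2sq_v m = euclid_v m * step R N ^+ d.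
Proof. by rewrite /l2sq_v -mulr_suml. Qed.

Lemma l2sq_sE phi : l2sq_s phi = euclid_s phi * step R N ^+ d.
Proof. by rewrite /l2sq_s -mulr_suml. Qed.

(** Young's inequality with weight ||A||, the weight that gives both squares the same coefficient
    after |A m|^2 <= ||A||^2 |m|^2. *)
Lemma inner_Aop_le phi m : (0 < d)%N ->
  2 * inner phi (Aop m) <= Anorm R d N * (l2sq_v m + l2sq_s phi).
Proof.
move=> d0; rewrite l2sq_vE l2sq_sE -mulrDl mulrA /inner -mulr_suml mulrA.
rewrite ler_wpM2r ?(ltW stepX_gt0)//.
have A0 := Anorm_gt0 d0; have := euclid_Aop_le_Anorm m.
set a := Anorm R d N => h.
have : \sum_x (2 * (phi x * Aop m x)) <= \sum_x (a * phi x ^+ 2 + a^-1 * Aop m x ^+ 2).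
  apply: ler_sum => x _; rewrite -subr_ge0.
  have -> : a * phi x ^+ 2 + a^-1 * Aop m x ^+ 2 - 2 * (phi x * Aop m x)
    = a^-1 * (a * phi x - Aop m x) ^+ 2 by field; rewrite gt_eqF.
  by rewrite mulr_ge0 ?sqr_ge0// invr_ge0 ltW.
rewrite -mulr_sumr big_split/= -!mulr_sumr => /le_trans; apply.
rewrite mulrDr addrC lerD//.
by rewrite mulrC ler_pdivrMr// -mulrA mulrC -mulrA -expr2 mulrC.
Qed.

End Grid.

(** * The primal-dual iteration *)


Section PrimalDual.
Context {R : realType} {d N : nat} (p : \bar R).
Context (N_gt0 : (0 < N)%N) (d_gt0 : (0 < d)%N) (p_ge1 : (1 <= p)%E).
Local Notation vfield := (vfield R d N).
Local Notation sfield := (sfield R d N).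
Local Notation state := (state R d N).
Local Notation mu := (stepsize R d N).
Implicit Types (m w : vfield) (phi psi rho : sfield) (z : state).

Lemma l2sq_v_ge0 m : 0 <= l2sq_v m.
Proof. by rewrite l2sq_vE mulr_ge0 ?euclid_v_ge0// ltW// stepX_gt0. Qed.

Lemma l2sq_s_ge0 phi : 0 <= l2sq_s phi.
Proof. by rewrite l2sq_sE mulr_ge0 ?euclid_s_ge0// ltW// stepX_gt0. Qed.

Lemma l2sq_v_le0 m : l2sq_v m <= 0 -> m = 0.
Proof.
rewrite l2sq_vE pmulr_lle0 ?stepX_gt0// => m0.
have /eqP : euclid_v m = 0 by apply/le_anti; rewrite m0 euclid_v_ge0.
rewrite psumr_eq0 => [|x _]; last by apply: sumr_ge0 => i _; exact: sqr_ge0.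
move=> /allP mx0; apply/ffunP => x; apply/rowP => i; rewrite ffunE mxE.
have /= := mx0 x (mem_index_enum _); rewrite psumr_eq0 => [|j _]; last exact: sqr_ge0.
by move=> /allP/(_ i (mem_index_enum _))/=; rewrite sqrf_eq0 => /eqP.
Qed.

Lemma l2sq_s_le0 phi : l2sq_s phi <= 0 -> phi = 0.
Proof.
rewrite l2sq_sE pmulr_lle0 ?stepX_gt0// => phi0.
have /eqP : euclid_s phi = 0 by apply/le_anti; rewrite phi0 euclid_s_ge0.
rewrite psumr_eq0 => [|x _]; last exact: sqr_ge0.
move=> /allP phix0; apply/ffunP => x; rewrite ffunE.
by have /= := phix0 x (mem_index_enum _); rewrite sqrf_eq0 => /eqP.
Qed.

Lemma vinnerBl m w v : vinner (m - w) v = vinner m v - vinner w v.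
Proof.
rewrite /vinner -sumrB; apply: eq_bigr => x _; rewrite -mulrBl -sumrB.
by congr (_ * _); apply: eq_bigr => i _; rewrite !ffunE !mxE mulrBl.
Qed.

Lemma vinnerC m w : vinner m w = vinner w m.
Proof.
apply: eq_bigr => x _; congr (_ * _); apply: eq_bigr => i _; exact: mulrC.
Qed.

Lemma l2sq_v_vinner m : l2sq_v m = vinner m m.
Proof.
by apply: eq_bigr => x _; congr (_ * _); apply: eq_bigr => i _; rewrite expr2.
Qed.

Lemma vinnerBr m w v : vinner v (m - w) = vinner v m - vinner v w.
Proof. by rewrite !(vinnerC v) vinnerBl. Qed.

Lemma innerBl phi psi (f : sfield) : inner (phi - psi) f = inner phi f - inner psi f.
Proof.
rewrite /inner -sumrB; apply: eq_bigr => x _.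
by rewrite -mulrBl -mulrBl !ffunE.
Qed.

Lemma innerC phi psi : inner phi psi = inner psi phi.
Proof. by apply: eq_bigr => x _; rewrite [phi x * _]mulrC. Qed.

Lemma innerBr phi psi (f : sfield) : inner f (phi - psi) = inner f phi - inner f psi.
Proof. by rewrite !(innerC f) innerBl. Qed.

Lemma innerZl (c : R) phi psi : inner (c *: phi) psi = c * inner phi psi.
Proof.
rewrite /inner mulr_sumr; apply: eq_bigr => x _.
by rewrite ffunE -[_ *: _]/(_ * _) !mulrA.
Qed.

Lemma innerDl phi psi (f : sfield) : inner (phi + psi) f = inner phi f + inner psi f.
Proof.
rewrite /inner -big_split/=; apply: eq_bigr => x _.
by rewrite -mulrDl -mulrDl ffunE.
Qed.

Lemma l2sq_s_inner phi : l2sq_s phi = inner phi phi.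
Proof. by apply: eq_bigr => x _; rewrite expr2. Qed.

Lemma mu_gt0 : 0 < mu.
Proof. by rewrite invr_gt0 mulr_gt0// Anorm_gt0. Qed.

Definition primal_update m phi : vfield :=
  [ffun x => prox p mu (m x - mu *: adjoint phi x)].

(** All terms carry the same weight h^d, so the problem for m decouples over the grid points: this
    is the proximal inequality summed over x, with the linear term moved back onto phi through the
    adjoint. *)
Lemma primal_update_optimality m phi w (m' := primal_update m phi) :
  objective p m' + (mu^-1 * vinner (m - m') (w - m') - inner phi (Aop (w - m')))
    <= objective p w.
Proof.
rewrite inner_Aop// /objective /vinner mulr_sumr -sumrB -big_split/=.
apply: ler_sum => x _; rewrite mulrA -mulrBl -mulrDl ler_wpM2r ?(ltW (stepX_gt0 _))//.
rewrite -(ler_pM2l mu_gt0) mulrDr mulrBr mulrA mulfV ?gt_eqF ?mu_gt0// mul1r.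
apply: le_trans (prox_optimality p mu (m x - mu *: adjoint phi x) p_ge1 (ltW mu_gt0) (w x)).
rewrite [m' x]ffunE lerD// mulr_sumr -sumrB le_eqVlt; apply/orP; left; apply/eqP.
by apply: eq_bigr => i _; rewrite /m' !ffunE !mxE; ring.
Qed.

Definition dual_update rho phi m m' : sfield :=
  phi + mu *: (Aop (m' *+ 2 - m) - rho).

Lemma alg1_stepE rho z : alg1_step p rho z =
  (primal_update z.1 z.2,
   dual_update rho z.2 z.1 (primal_update z.1 z.2)).
Proof.
have mu0 := mu_gt0; have mun0 : mu != 0 by rewrite gt_eqF.
rewrite /alg1_step; set m' := primal_update z.1 z.2.
have -> : argmin z.1 (fun m => lagrangian p rho m z.2 + (2 * mu)^-1 * l2sq_v (m - z.1))
    = m'.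
  set G := fun m => _.
  (* Strong convexity yields both facts needed about [argmin]: m' is a minimizer, and any other
     minimizer is at distance 0 from it. *)
  have Gle w : (2 * mu)^-1 * l2sq_v (w - m') <= G w - G m'.
    have := primal_update_optimality z.1 z.2 w; rewrite /= -/m' AopB//.
    rewrite /G /lagrangian !l2sq_v_vinner !vinnerBl !vinnerBr !innerBr.
    rewrite !(vinnerC m') !(vinnerC z.1 w) invfM; lra.
  apply: xget_unique => [w /=|w /= wmin].
    by rewrite -subr_ge0 (le_trans _ (Gle w))// mulr_ge0 ?l2sq_v_ge0// invr_ge0 mulr_ge0 ?ltW.
  apply/eqP; rewrite -subr_eq0; apply/eqP/l2sq_v_le0.
  have := le_trans (Gle w) (_ : _ <= 0); rewrite pmulr_rle0 ?invr_gt0 ?mulr_gt0//.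
  by apply; rewrite subr_le0; exact: wmin.
congr pair.
pose g := Aop (m' *+ 2 - z.1) - rho; set phi' := dual_update _ _ _ _.
have gE : g = mu^-1 *: (phi' - z.2).
  by rewrite /phi' /dual_update -/g [z.2 + _]addrC addrK scalerA mulVf// scale1r.
rewrite /argmax; set G := fun psi => _.
(* The dual problem is exactly quadratic, so here the growth bound is an identity. *)
have GE psi : G psi - G phi' = (2 * mu)^-1 * l2sq_s (psi - phi').
  rewrite /G /lagrangian -/g gE !(innerC _ (_ *: _)) !innerZl.
  rewrite !l2sq_s_inner !innerBl !innerBr !(innerC phi') !(innerC z.2 psi) invfM.
  by lra.
have G0 : 0 < (2 * mu)^-1 by rewrite invr_gt0 mulr_gt0.
apply: xget_unique => [psi /=|psi /= psimin].
  by rewrite -subr_ge0 GE mulr_ge0 ?l2sq_s_ge0// ltW.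
apply/eqP; rewrite -subr_eq0; apply/eqP/l2sq_s_le0.
by rewrite -(pmulr_rle0 _ G0) -GE subr_le0; exact: psimin.
Qed.

(** The Lagrangian is affine in phi, so it has a maximum only if its slope A m - rho vanishes;
    moving phi along this slope shows it. *)
Lemma saddle_feasible rho z : saddle_points p rho z -> Aop z.1 = rho.
Proof.
move=> zs; apply/eqP; rewrite -subr_eq0; apply/eqP/l2sq_s_le0.
have [+ _] := zs 0 (z.2 + (Aop z.1 - rho)).
by rewrite /lagrangian lerD2l innerDl l2sq_s_inner gerDl.
Qed.

Lemma saddle_optimal rho z m : saddle_points p rho z ->
  objective p z.1 <= objective p m + inner z.2 (Aop m - Aop z.1).
Proof.
move=> zs; have [_] := zs m 0; rewrite /lagrangian -(saddle_feasible _ _ zs) subrr.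
by rewrite {1}/inner big1 ?addr0// => x _; rewrite ffunE mulr0 mul0r.
Qed.

(** A saddle point puts rho in the range of A. Hence A m - rho sums to zero for every m, and the
    Lagrangian does not see a constant added to phi. *)
Lemma saddle_shift rho z (c : R) : saddle_points p rho z ->
  saddle_points p rho (z.1, z.2 - [ffun=> c]).
Proof.
move=> zs.
have shift m phi : lagrangian p rho m (phi - [ffun=> c]) = lagrangian p rho m phi.
  rewrite /lagrangian innerBl; congr (_ + _); rewrite [X in _ - X](_ : _ = 0) ?subr0//.
  rewrite /inner; under eq_bigr do rewrite ffunE -mulrA mulrCA.
  rewrite -(saddle_feasible _ _ zs) -AopB//.
  under eq_bigr do rewrite mulrCA.
  by rewrite -!mulr_sumr -mulr_suml sum_Aop// mul0r mulr0.
move=> m phi; rewrite /= !shift.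
exact: zs.
Qed.

Lemma saddle_centered rho : saddle_points p rho !=set0 ->
  exists2 z, saddle_points p rho z & \sum_x z.2 x = 0.
Proof.
move=> [z zs]; pose c := (\sum_x z.2 x) / #|{: grid d N}|%:R.
exists (z.1, z.2 - [ffun=> c]); first exact: saddle_shift.
under eq_bigr do rewrite !ffunE.
rewrite sumrB sumr_const -mulr_natr divfK ?subrr//.
by rewrite pnatr_eq0 -lt0n; apply/card_gt0P; exists [ffun=> ord0].
Qed.

Definition metric z : R :=
  mu^-1 * l2sq_v z.1 + mu^-1 * l2sq_s z.2 - 2 * inner z.2 (Aop z.1).

Lemma mu_inv : mu^-1 = 2 * Anorm R d N.
Proof. by rewrite invrK. Qed.

Lemma metric_ge0 z : 0 <= metric z.
Proof.
rewrite /metric mu_inv -mulrDr; have := inner_Aop_le N_gt0 z.2 z.1 d_gt0.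
have : 0 <= Anorm R d N * (l2sq_v z.1 + l2sq_s z.2).
  by rewrite mulr_ge0 ?Anorm_ge0// addr_ge0 ?l2sq_v_ge0 ?l2sq_s_ge0.
by lra.
Qed.

(** 3 = 2 + 1: the factor 1/mu = 2 ||A||, and ||A|| for the cross term, which is bounded at - phi
    because of its sign. *)
Lemma metric_le z : metric z <= 3 * Anorm R d N * l2sq z.
Proof.
rewrite /metric mu_inv -mulrDr /l2sq; have := inner_Aop_le N_gt0 (- z.2) z.1 d_gt0.
have -> : l2sq_s (- z.2) = l2sq_s z.2.
  by apply: eq_bigr => x _; rewrite ffunE sqrrN.
rewrite -[- z.2]scaleN1r innerZl; lra.
Qed.

Lemma residualE z z' : residual z z' = metric (z' - z).
Proof. by []. Qed.

(** With B the bilinear form of Q, the claim is B(z - z', zs - z') <= 0 after polarization.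
    Optimality of m' tested at zs, optimality of zs tested at m', and the dual update paired with zs
    - z' add up to this; the extrapolation 2 m' - m supplies the cross term that makes B
    symmetric. *)
Lemma alg1_step_descent rho z zs : saddle_points p rho zs ->
  let z' := alg1_step p rho z in
  metric (z' - zs) + residual z z' <= metric (z - zs).
Proof.
move=> zss /=; rewrite residualE alg1_stepE; set m' := primal_update _ _.
set phi' := dual_update _ _ _ _.
have := primal_update_optimality z.1 z.2 zs.1; rewrite /= -/m'.
have := saddle_optimal rho zs m' zss.
have dualE : mu^-1 *: (phi' - z.2) = Aop m' - (Aop z.1 - Aop m') - Aop zs.1.
  rewrite /phi' /dual_update [z.2 + _]addrC addrK scalerA mulVf ?gt_eqF ?mu_gt0//.
  rewrite scale1r (saddle_feasible _ _ zss); congr (_ - _).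
  by rewrite -!AopB// opprB addrA -mulr2n.
have := innerZl mu^-1 (phi' - z.2) (zs.2 - phi'); rewrite dualE.
rewrite /metric /= !AopB// !l2sq_v_vinner !l2sq_s_inner.
rewrite !(vinnerBl, vinnerBr, innerBl, innerBr).
rewrite !(vinnerC m') !(vinnerC z.1 zs.1) !(innerC phi') !(innerC z.2 zs.2).
rewrite !(innerC (Aop _)); lra.
Qed.

Lemma sum_residual_le rho z0 zs K : saddle_points p rho zs ->
  \sum_(k < K) alg1_residual p rho z0 k <= metric (z0 - zs).
Proof.
move=> zss; suff : metric (alg1_iter p rho z0 K - zs)
    + \sum_(k < K) alg1_residual p rho z0 k <= metric (z0 - zs).
  by apply: le_trans; rewrite lerDr metric_ge0.
elim: K => [|K IH]; first by rewrite big_ord0 addr0.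
rewrite big_ord_recr/= addrCA addrC; apply: le_trans IH; rewrite lerD2r.
exact: alg1_step_descent.
Qed.

Lemma alg1_niter_le rho z0 zs eps : saddle_points p rho zs -> 0 < eps ->
  (alg1_niter p rho z0 eps <= (3 * Anorm R d N * l2sq (z0 - zs) / eps)%:E)%E.
Proof.
move=> zss eps0.
(* Serves twice: with K beyond the bound it shows that the test is met at some point, and with K the
   first such index it bounds the count. *)
have run K : (forall k, (k < K)%N -> eps <= alg1_residual p rho z0 k) ->
    K%:R <= 3 * Anorm R d N * l2sq (z0 - zs) / eps.
  move=> Kle; rewrite ler_pdivlMr//.
  apply: le_trans (metric_le _); apply: le_trans (sum_residual_le rho z0 zs K zss).
  rewrite mulr_natl -[K in _ *+ K]card_ord -sumr_const.
  by apply: ler_sum => k _; apply: Kle.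
have stop : exists k, alg1_residual p rho z0 k < eps.
  apply/not_existsP => nostop.
  set B := 3 * _ * _ / eps in run.
  have := run (Num.bound `|B|); rewrite leNgt => noB.
  suff /noB/negP : forall k, (k < Num.bound `|B|)%N -> eps <= alg1_residual p rho z0 k.
    by apply; rewrite (le_lt_trans (ler_norm B))// archi_boundP.
  by move=> k _; rewrite leNgt; apply/negP/nostop.
case: (ex_minnP stop) => K Kstop Kmin.
have Kle k : (k < K)%N -> eps <= alg1_residual p rho z0 k.
  by move=> kK; rewrite leNgt; apply/negP => /Kmin; rewrite leqNgt kK.
apply: (@le_trans _ _ (K%:R)%:E); last by rewrite lee_fin run.
by apply: ereal_inf_lbound; exists K.
Qed.

End PrimalDual.

(** * Stability of the prolongation *)


Lemma card_le_inj {T T' : finType} (A : {set T}) (f : T -> T') :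
  {in A &, injective f} -> (#|A| <= #|T'|)%N.
Proof. by move=> finj; rewrite -(card_in_imset finj) max_card. Qed.

Section Interpolation.
Context {R : realType} {d N : nat}.
Implicit Types (x : grid d N.*2) (y : grid d N).

Lemma neighboursP x y : y \in neighbours x ->
  forall j, (x j = (y j).*2 :> nat) \/ (x j = (y j).*2.+1 :> nat)
    \/ ((x j).+1 = (y j).*2 :> nat).
Proof.
rewrite inE => /forallP yx j; move: (yx j); case: ifP => _.
  by move=> h; lia.
by move/eqP => ->; left.
Qed.

Lemma card_neighbours x : (#|neighbours x| <= 2 ^ d)%N.
Proof.
apply: (@leq_trans #|{: {ffun 'I_d -> bool}}|); last first.
  by rewrite card_ffun card_bool card_ord.
(* A neighbour is determined by whether each y_j is the rounded-down half of x_j; for even x_j there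
   is no other choice. *)
apply: (card_le_inj _ (fun y : grid d N => [ffun j => (y j : nat) == (x j)./2])).
move=> y y' yx y'x /ffunP yy'; apply/ffunP => j; apply/val_inj.
move: (yy' j); rewrite !ffunE /=.
move: yx y'x; rewrite !inE => /forallP/(_ j) h /forallP/(_ j) h'.
case: eqP => e; case: eqP => e' // _; first by rewrite e e'.
by move: h h'; case: ifP => oddx h h'; lia.
Qed.

Lemma card_neighbouring y : (#|[set x : grid d N.*2 | y \in neighbours x]%SET| <= 3 ^ d)%N.
Proof.
apply: (@leq_trans #|{: {ffun 'I_d -> 'I_3}}|); last by rewrite card_ffun !card_ord.
(* The offset x_j - 2 y_j lies in {-1, 0, 1}; the successor keeps the subtraction from being
   truncated. *)
apply: (card_le_inj _ (fun x : grid d N.*2 => [ffun j => inord ((x j).+1 - (y j).*2)])).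
have nbr x : x \in [set x | y \in neighbours x]%SET -> y \in neighbours x.
  by rewrite finset.in_set.
move=> x x' /nbr/neighboursP xy /nbr/neighboursP x'y /ffunP xx'.
apply/ffunP => j; apply/val_inj; move: (xx' j); rewrite !ffunE /=.
move=> /(congr1 val); rewrite /= !inordK.
- by case: (xy j) (x'y j); lia.
- by case: (x'y j); lia.
- by case: (xy j); lia.
Qed.

(** Cauchy-Schwarz leaves a factor 1/#|S|, which is dropped. Over an empty set the average is 0, as
    the inverse of 0 is 0. *)
Lemma average_sqr_le (T : finType) (S : {set T}) (F : T -> R) :
  average S F ^+ 2 <= \sum_(y in S) F y ^+ 2.
Proof.
rewrite /average; have [S0|S0] := posnP #|S|.
  by rewrite S0 invr0 mulr0 expr0n sumr_ge0// => y _; exact: sqr_ge0.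
have n0 : 0 < #|S|%:R :> R by rewrite ltr0n.
rewrite expr_div_n ler_pdivrMr ?exprn_gt0//.
apply: le_trans (sqr_sum_le _ _) _; rewrite mulrC ler_wpM2l//.
  by apply: sumr_ge0 => y _; exact: sqr_ge0.
by rewrite ler_eXnr// ler1n.
Qed.

(** After exchanging the sums, 3^d counts the fine points whose average may involve a given coarse
    value. *)
Lemma sum_average_sqr_le (S : grid d N.*2 -> {set grid d N}) (F : grid d N -> R) :
  (forall x, S x \subset neighbours x) ->
  \sum_x average (S x) F ^+ 2 <= 3 ^+ d * \sum_y F y ^+ 2.
Proof.
move=> Sx; apply: (@le_trans _ _ (\sum_x \sum_(y in neighbours x) F y ^+ 2)).
  apply: ler_sum => x _; apply: le_trans (average_sqr_le _ _ _) _.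
  rewrite big_mkcond [leRHS]big_mkcond; apply: ler_sum => y _.
  case: ifP => [/(fintype.subsetP (Sx x)) ->//|_].
  by case: ifP => // _; exact: sqr_ge0.
rewrite (exchange_big_dep xpredT)//= mulr_sumr; apply: ler_sum => y _.
rewrite (eq_bigl (fun x => x \in [set x | y \in neighbours x]%SET)) => [|x]; last by rewrite [RHS]inE.
rewrite sumr_const -[leLHS]mulr_natl ler_wpM2r ?sqr_ge0// -natrX ler_nat.
exact: card_neighbouring.
Qed.

Lemma averageB (T : finType) (S : {set T}) (F G : T -> R) :
  average S (fun t => F t - G t) = average S F - average S G.
Proof. by rewrite /average sumrB mulrBl. Qed.

Lemma interpolateB (z z' : state R d N) :
  interpolate (z - z') = interpolate z - interpolate z'.
Proof.
congr pair; apply/ffunP => x; last first.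
  by rewrite !ffunE -averageB; congr (_ / _); apply: eq_bigr => y _; rewrite !ffunE.
apply/rowP => i; rewrite !ffunE !mxE -averageB.
by congr (_ / _); apply: eq_bigr => y _; rewrite !ffunE !mxE.
Qed.

Lemma l2sq_interpolate_le (z : state R d N) : (0 < N)%N ->
  l2sq (interpolate z) <= 3 ^+ d * l2sq z.
Proof.
move=> N0.
have step0 : 0 <= step R N.*2 ^+ d by rewrite exprn_ge0// invr_ge0.
have stepX_le : step R N.*2 ^+ d <= step R N ^+ d.
  rewrite lerXn2r ?nnegrE ?invr_ge0// lef_pV2 ?posrE ?ltr0n ?double_gt0//.
  by rewrite ler_nat -addnn leq_addr.
rewrite /l2sq mulrDr lerD//.
  rewrite !l2sq_vE mulrA ler_pM ?euclid_v_ge0//.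
  rewrite /euclid_v exchange_big [in leRHS]exchange_big/= mulr_sumr.
  apply: ler_sum => i _; under eq_bigr do rewrite ffunE mxE.
  apply: sum_average_sqr_le => x; case: ifP => // _.
  by apply/fintype.subsetP => y; rewrite inE => /andP[].
rewrite !l2sq_sE mulrA ler_pM ?euclid_s_ge0//.
by rewrite /euclid_s; under eq_bigr do rewrite ffunE; exact: sum_average_sqr_le.
Qed.

Lemma l2sqB_le (a b c : state R d N) :
  l2sq (a - c) <= 2 * l2sq (a - b) + 2 * l2sq (b - c).
Proof.
have sqrD_le (u v w : R) : (u - w) ^+ 2 <= 2 * (u - v) ^+ 2 + 2 * (v - w) ^+ 2.
  by have := sqr_ge0 (u - v - (v - w)); lra.
have h0 : 0 <= step R N ^+ d by rewrite exprn_ge0// invr_ge0.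
have hv : l2sq_v (a - c).1 <= 2 * l2sq_v (a - b).1 + 2 * l2sq_v (b - c).1.
  rewrite !l2sq_vE !mulrA -mulrDl ler_wpM2r// /euclid_v !mulr_sumr -big_split.
  apply: ler_sum => x _ /=; rewrite !mulr_sumr -big_split; apply: ler_sum => i _ /=.
  by rewrite !ffunE !mxE.
have hs : l2sq_s (a - c).2 <= 2 * l2sq_s (a - b).2 + 2 * l2sq_s (b - c).2.
  rewrite !l2sq_sE !mulrA -mulrDl ler_wpM2r// /euclid_s !mulr_sumr -big_split.
  by apply: ler_sum => x _ /=; rewrite !ffunE.
by rewrite /l2sq; lra.
Qed.

End Interpolation.

(** * Operation counts *)


Section Programs.
Context {R : realType} {d : nat} {p : \bar R} {kappa : nat}.
Context {X : Type} {inp : set (X -> R)}.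
Implicit Types (S T U : set (X -> R)) (f g : X -> R) (n k : nat).
Local Notation computable := (computable d p kappa inp).

(** [computable] describes whole programs from the start. This form is relative: any program already
    holding S extends by at most n operations to one that also holds T and loses nothing, so counts
    can be added along a sequence of subprograms. *)
Definition reach n S T := forall k S0, computable k S0 -> S `<=` S0 ->
  exists k' S', [/\ computable k' S', (k' <= k + n)%N, S0 `<=` S' & T `<=` S'].

Lemma computable_cst n S (c : R) : computable n S -> S (cst c).
Proof.
elim=> [|m S' o f g _ IH _ _|m S' lam v _ IH _]; [right|left|left] => //.
Qed.

Lemma reach_le m n S T : (m <= n)%N -> reach m S T -> reach n S T.
Proof.
move=> mn rT k S0 kS0 SS0; have [k' [S' [? k'le ? ?]]] := rT k S0 kS0 SS0.
by exists k', S'; split=> //; rewrite (leq_trans k'le)// leq_add2l.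
Qed.

Lemma reach_sub n S T U : T `<=` U -> reach n S U -> reach n S T.
Proof.
move=> TU rU k S0 kS0 SS0; have [k' [S' [? ? ? US']]] := rU k S0 kS0 SS0.
by exists k', S'; split=> // f /TU/US'.
Qed.

Lemma reach_weaken n S T U : S `<=` U -> reach n S T -> reach n U T.
Proof. by move=> SU rT k S0 kS0 US0; apply: rT => // f /SU/US0. Qed.

Lemma reach_bind m n S T U : reach m S T -> reach n (S `|` T) U ->
  reach (m + n) S (T `|` U).
Proof.
move=> rT rU k S0 kS0 SS0; have [k1 [S1 [kS1 k1le S01 TS1]]] := rT k S0 kS0 SS0.
have [|k2 [S2 [kS2 k2le S12 US2]]] := rU k1 S1 kS1.
  by move=> f [/SS0/S01|/TS1].
exists k2, S2; split=> //; last 2 first.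
- by move=> f /S01/S12.
- by move=> f [/TS1/S12|/US2].
by rewrite (leq_trans k2le)// addnA leq_add2r.
Qed.

Lemma reach_union m n S T U : reach m S T -> reach n S U -> reach (m + n) S (T `|` U).
Proof.
by move=> rT rU; apply: reach_bind rT _; apply: reach_weaken rU => f; left.
Qed.

Lemma reach_bigcup (I : Type) (r : seq I) n S (T : I -> set (X -> R)) :
  (forall i, reach n S (T i)) ->
  reach (size r * n) S [set f | exists2 i, List.In i r & T i f].
Proof.
move=> rT; elim: r => [|i r IH] /=.
  by move=> k S0 kS0 SS0; exists k, S0; split=> //; rewrite ?addn0// => f [].
rewrite mulSn; apply: reach_sub (reach_union _ _ _ _ _ (rT i) IH).
by move=> f [j [<-|jr] Tf]; [left|right; exists j].
Qed.

Lemma reach_family (I : finType) n S (T : I -> set (X -> R)) :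
  (forall i, reach n S (T i)) -> reach (#|I| * n) S [set f | exists i, T i f].
Proof.
move=> rT; rewrite cardE; apply: reach_sub (reach_bigcup _ (enum I) _ _ T rT).
move=> f [i Tf]; exists i => //.
have : i \in enum I by rewrite mem_enum.
by elim: (enum I) => //= j r IH; rewrite inE => /orP[/eqP->|/IH]; [left|right].
Qed.

Lemma reach_mem S f : S f -> reach 0 S [set f].
Proof.
by move=> Sf k S0 kS0 SS0; exists k, S0; split=> //; rewrite ?addn0// => g ->; exact: SS0.
Qed.

Lemma reach_cst S (c : R) : reach 0 S [set cst c].
Proof.
move=> k S0 kS0 SS0; exists k, S0; split=> //; rewrite ?addn0// => g ->.
exact: computable_cst kS0.
Qed.

Lemma reach_arith o m n S f g : reach m S [set f] -> reach n S [set g] ->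
  reach (m + n).+1 S [set fun z => arith_eval o (f z) (g z)].
Proof.
move=> rf rg k S0 kS0 SS0.
have [k' [S' [kS' k'le S0S' TS']]] := reach_union _ _ _ _ _ rf rg k S0 kS0 SS0.
have Sf : S' f by apply: TS'; left.
have Sg : S' g by apply: TS'; right.
exists k'.+1, (S' `|` [set fun z => arith_eval o (f z) (g z)]); split.
- exact: computable_arith.
- by rewrite addnS ltnS.
- by move=> h /S0S'; left.
- by move=> h ->; right.
Qed.

Lemma reach_add m n S f g : reach m S [set f] -> reach n S [set g] ->
  reach (m + n).+1 S [set fun z => f z + g z].
Proof. exact: (reach_arith Add). Qed.

Lemma reach_subr m n S f g : reach m S [set f] -> reach n S [set g] ->
  reach (m + n).+1 S [set fun z => f z - g z].
Proof. exact: (reach_arith Defs.Sub). Qed.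

Lemma reach_mul m n S f g : reach m S [set f] -> reach n S [set g] ->
  reach (m + n).+1 S [set fun z => f z * g z].
Proof. exact: (reach_arith Mul). Qed.

Lemma reach_scale n S (c : R) f : reach n S [set f] ->
  reach n.+1 S [set fun z => c * f z].
Proof. by move=> rf; have := reach_mul _ _ _ _ _ (reach_cst S c) rf. Qed.

Lemma reach_sum (I : Type) (r : seq I) n S (F : I -> X -> R) :
  (forall i, reach n S [set F i]) ->
  reach (size r * n.+1) S [set fun z => \sum_(i <- r) F i z].
Proof.
move=> rF; elim: r => [|i r IH] /=.
  by under eq_fun do rewrite big_nil; exact: reach_cst.
under eq_fun do rewrite big_cons.
by rewrite mulSn addSn; exact: reach_add.
Qed.

Lemma reach_sum_fin (I : finType) n S (F : I -> X -> R) :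
  (forall i, reach n S [set F i]) ->
  reach (#|I| * n.+1) S [set fun z => \sum_i F i z].
Proof.
move=> rF; rewrite cardT; under eq_fun do rewrite -big_enum.
exact: reach_sum.
Qed.

Lemma reach_prox (lam : R) S (v : 'I_d -> X -> R) : 0 <= lam ->
  (forall i, S (v i)) ->
  reach (kappa * d) S
    [set f | exists i, f = fun z => prox p lam (\row_j v j z) 0 i].
Proof.
move=> lam0 Sv k S0 kS0 SS0.
exists (k + kappa * d)%N,
  (S0 `|` range (fun i z => prox p (NngNum lam0)%:num (\row_j v j z) 0 i)); split=> //.
- by apply: computable_prox => // i; exact: SS0.
- by move=> h [i ->]; right; exists i.
Qed.

Lemma op_cost_le n out : reach n inp out ->
  (op_cost d p kappa inp out <= (n%:R)%:E)%E.
Proof.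
move=> rout; have := rout 0%N _ (computable_start d p kappa inp).
move=> [f|k [S [kS kn _ outS]]]; first by left.
apply: (@le_trans _ _ (k%:R)%:E); last by rewrite lee_fin ler_nat.
by apply: ereal_inf_lbound; exists k => //; exists S.
Qed.

End Programs.

(** * Cost of one iteration and of one interpolation *)

Section GridCost.
Context {R : realType} {d N : nat} {p : \bar R} {kappa : nat}.
Context (N_gt0 : (0 < N)%N) (d_gt0 : (0 < d)%N) (p_ge1 : (1 <= p)%E).
Local Notation state := (state R d N).
Local Notation G := #|{: grid d N}|.
Local Notation mu := (stepsize R d N).

Local Notation reach := (@reach R d p kappa state (@coordinates R d N)).

Lemma coordinates_v (x : grid d N) i :
  coordinates (fun z : state => z.1 x 0 i).
Proof. by left; exists x, i. Qed.

Lemma coordinates_s (x : grid d N) : coordinates (fun z : state => z.2 x).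
Proof. by right; exists x. Qed.

Definition prox_argument (x : grid d N) (i : 'I_d) (z : state) : R :=
  z.1 x 0 i - mu * adjoint z.2 x 0 i.

Lemma reach_prox_argument x i :
  reach 5 (@coordinates R d N) [set prox_argument x i].
Proof.
(* The boundary test depends on x alone, so it becomes a multiplication by a constant 0 or 1 in the
   program. *)
have -> : prox_argument x i = fun z => z.1 x 0 i -
    (mu * N%:R) * ((if (x i < N)%N then 1 else 0) * (z.2 x - z.2 (grid_succ x i))).
  apply/funext => z; rewrite /prox_argument ffunE mxE mulrA.
  by case: ifP; rewrite ?mul1r ?mul0r.
apply: (@reach_le _ _ _ _ _ _ (0 + (0 + 0).+3).+1) => //.
apply: reach_subr; first exact/reach_mem/coordinates_v.
do 2!apply: reach_scale.
by apply: reach_subr; exact/reach_mem/coordinates_s.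
Qed.

Lemma reach_Dop S (V : grid d N -> 'I_d -> state -> R) n i x :
  (forall x i, reach n S [set V x i]) ->
  reach (2 * n + 4) S
    [set fun z => Dop i [ffun x => \row_i V x i z] x].
Proof.
move=> rV; have -> : (fun z => Dop i [ffun x => \row_i V x i z] x) = fun z =>
    N%:R * ((if (x i < N)%N then 1 else 0) * V x i z
            - (if (0 < x i)%N then 1 else 0) * V (grid_pred x i) i z).
  apply/funext => z; rewrite DopE// !ffunE !mxE.
  by case: ifP; case: ifP; rewrite ?mul1r ?mul0r.
apply: (@reach_le _ _ _ _ _ _ (n.+1 + n.+1).+2); first by lia.
by apply: reach_scale; apply: reach_subr; apply: reach_scale; exact: rV.
Qed.

Lemma reach_Aop S (V : grid d N -> 'I_d -> state -> R) n x :
  (forall x i, reach n S [set V x i]) ->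
  reach (d * (2 * n + 5)) S [set fun z => Aop [ffun x => \row_i V x i z] x].
Proof.
move=> rV; apply: (@reach_le _ _ _ _ _ _ (#|'I_d| * (2 * n + 4).+1)).
  by rewrite card_ord leq_mul2l; apply/orP; right; lia.
have -> : (fun z => Aop [ffun x => \row_i V x i z] x) =
    (fun z => \sum_i Dop i [ffun x => \row_i V x i z] x).
  by apply/funext => z; rewrite ffunE.
by apply: reach_sum_fin => i; exact: reach_Dop.
Qed.

Lemma reach_row_sqr S (V : grid d N -> 'I_d -> state -> R) n :
  (forall x i, reach n S [set V x i]) ->
  reach (G * (d * (2 * n + 2) + 2)) S
    [set fun z => l2sq_v ([ffun x => \row_i V x i z] : vfield R d N)].
Proof.
move=> rV; have -> : (fun z => l2sq_v ([ffun x => \row_i V x i z] : vfield R d N)) =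
    (fun z => \sum_x step R N ^+ d * \sum_i V x i z * V x i z).
  apply/funext => z; apply: eq_bigr => x _; rewrite mulrC; congr (_ * _).
  by apply: eq_bigr => i _; rewrite ffunE mxE expr2.
apply: (@reach_le _ _ _ _ _ _ (G * (#|'I_d| * (n + n).+2).+2)).
  by rewrite card_ord addn2 !mul2n !addnS !addn0 -addnn.
apply: reach_sum_fin => x; apply: reach_scale; apply: reach_sum_fin => i.
by apply: reach_mul; exact: rV.
Qed.

Lemma reach_scalar_sqr S (W : grid d N -> state -> R) n :
  (forall x, reach n S [set W x]) ->
  reach (G * (2 * n + 3)) S [set fun z => l2sq_s ([ffun x => W x z] : sfield R d N)].
Proof.
move=> rW; have -> : (fun z => l2sq_s ([ffun x => W x z] : sfield R d N)) =
    (fun z => \sum_x step R N ^+ d * (W x z * W x z)).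
  by apply/funext => z; apply: eq_bigr => x _; rewrite mulrC ffunE expr2.
apply: (@reach_le _ _ _ _ _ _ (G * (n + n).+3)).
  by rewrite mul2n !addnS addn0 -addnn.
by apply: reach_sum_fin => x; apply: reach_scale; apply: reach_mul; exact: rW.
Qed.

Lemma reach_inner_Aop S (V : grid d N -> 'I_d -> state -> R) (W : grid d N -> state -> R)
    m n :
  (forall x i, reach m S [set V x i]) -> (forall x, reach n S [set W x]) ->
  reach (G * (n + d * (2 * m + 5) + 3)) S
    [set fun z => inner [ffun x => W x z] (Aop [ffun x => \row_i V x i z])].
Proof.
move=> rV rW.
have -> : (fun z => inner [ffun x => W x z] (Aop [ffun x => \row_i V x i z])) =
    (fun z => \sum_x step R N ^+ d * (W x z * Aop [ffun x => \row_i V x i z] x)).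
  by apply/funext => z; apply: eq_bigr => x _; rewrite mulrC ffunE.
apply: (@reach_le _ _ _ _ _ _ (G * (n + d * (2 * m + 5)).+3)); first by rewrite addn3.
apply: reach_sum_fin => x; apply: reach_scale; apply: reach_mul; first exact: rW.
exact: reach_Aop.
Qed.

Context (rho : sfield R d N).
Local Notation C := (@coordinates R d N).

Let prox_arguments : set (state -> R) := [set f | exists x i, f = prox_argument x i].
Let new_primal : set (state -> R) :=
  [set f | exists x i, f = fun z => (alg1_step p rho z).1 x 0 i].
Let new_dual : set (state -> R) :=
  [set f | exists x, f = fun z => (alg1_step p rho z).2 x].

Lemma reach_prox_arguments : reach (G * (d * 5)) C prox_arguments.
Proof.
apply: reach_family => x; rewrite -[X in reach (X * _)](card_ord d).
exact: (reach_family _ _ _ _ (fun i => reach_prox_argument x i)).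
Qed.

Lemma reach_new_primal : reach (G * (kappa * d)) prox_arguments new_primal.
Proof.
have mu0 : 0 <= mu by rewrite ltW// mu_gt0.
have r (x : grid d N) : reach (kappa * d) prox_arguments
    [set f | exists i, f = fun z => prox p mu (\row_j prox_argument x j z) 0 i].
  by apply: reach_prox => // i; exists x, i.
apply: reach_sub (reach_family _ _ _ _ r) => _ [x [i ->]]; exists x, i; apply/funext => z.
rewrite alg1_stepE//= ffunE; congr (prox _ _ _ _ _).
by apply/rowP => j; rewrite !mxE /prox_argument.
Qed.

Lemma reach_new_dual : reach (G * (d * 9 + 3)) (C `|` new_primal) new_dual.
Proof.
apply: reach_family => x.
(* The extrapolation costs 2 operations as m' + m' - m and is counted afresh at each use, whence 2 *
   2 + 5 = 9 per direction. *)
pose V (x : grid d N) (i : 'I_d) (z : state) : R :=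
  (alg1_step p rho z).1 x 0 i + (alg1_step p rho z).1 x 0 i - z.1 x 0 i.
have -> : (fun z => (alg1_step p rho z).2 x) =
    fun z => z.2 x + mu * (Aop [ffun x => \row_i V x i z] x - rho x).
  apply/funext => z; rewrite {1}alg1_stepE//= /dual_update !ffunE -[_ *: _]/(_ * _).
  congr (_ + _ * (_ - _)); apply: eq_bigr => i _; rewrite !DopE//.
  congr (_ * _); congr (_ - _); case: ifP => // _;
    by rewrite /V alg1_stepE//= mulr2n; set m' := primal_update _ _ _; rewrite !ffunE !mxE.
apply: (@reach_le _ _ _ _ _ _ (0 + (d * (2 * 2 + 5) + 0).+2).+1).
  by rewrite add0n addn0 addn3.
apply: reach_add; first by apply: reach_mem; left; exact: coordinates_s.
apply: reach_scale; apply: reach_subr; last exact: reach_cst.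
apply: reach_Aop => y i; apply: (@reach_le _ _ _ _ _ _ ((0 + 0).+1 + 0).+1) => //.
apply: reach_subr; last by apply: reach_mem; left; exact: coordinates_v.
by apply: reach_add; apply: reach_mem; right; exists y, i.
Qed.

Lemma reach_residual : reach (G * (d * 11 + 14) + 5) (C `|` new_primal `|` new_dual)
  [set fun z => residual z (alg1_step p rho z)].
Proof.
set S := _ `|` new_dual.
pose V (x : grid d N) (i : 'I_d) (z : state) : R :=
  (alg1_step p rho z).1 x 0 i - z.1 x 0 i.
pose W (x : grid d N) (z : state) : R := (alg1_step p rho z).2 x - z.2 x.
have rV x i : reach 1 S [set V x i].
  apply: (@reach_subr _ _ _ _ _ _ 0 0); apply: reach_mem.
    by left; right; exists x, i.
  by left; left; exact: coordinates_v.
have rW x : reach 1 S [set W x].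
  apply: (@reach_subr _ _ _ _ _ _ 0 0); apply: reach_mem.
    by right; exists x.
  by left; left; exact: coordinates_s.
have -> : (fun z => residual z (alg1_step p rho z)) = fun z =>
    mu^-1 * l2sq_v ([ffun x => \row_i V x i z] : vfield R d N)
    + mu^-1 * l2sq_s ([ffun x => W x z] : sfield R d N)
    - 2 * inner [ffun x => W x z] (Aop [ffun x => \row_i V x i z]).
  apply/funext => z.
  have -> : [ffun x => \row_i V x i z] = (alg1_step p rho z).1 - z.1 :> vfield R d N.
    by apply/ffunP => x; apply/rowP => i; rewrite !ffunE !mxE.
  have -> : [ffun x => W x z] = (alg1_step p rho z).2 - z.2 :> sfield R d N.
    by apply/ffunP => x; rewrite !ffunE.
  by [].
have := reach_subr _ _ _ _ _
  (reach_add _ _ _ _ _ (reach_scale _ _ mu^-1 _ (reach_row_sqr _ _ _ rV))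
    (reach_scale _ _ mu^-1 _ (reach_scalar_sqr _ _ _ rW)))
  (reach_scale _ _ 2 _ (reach_inner_Aop _ _ _ _ _ rV rW)).
by apply: reach_le; lia.
Qed.

Lemma iteration_cost_le :
  (iteration_cost p kappa rho <= ((kappa * d + 25 * d + 22) * G)%:R%:E)%E.
Proof.
(* The coefficients are 25 = 5 + 9 + 11 and 22 = 3 + 14 + 5; the last 5 operations occur once per
   iteration and are absorbed because there is at least one grid point. *)
have G0 : (0 < G)%N by apply/card_gt0P; exists [ffun=> ord0].
have r1 := reach_prox_arguments.
have r2 := reach_bind _ _ _ _ _ r1 (reach_weaken _ _ _ _ (@subsetUr _ _ _) reach_new_primal).
have r3 := reach_bind _ _ _ _ _ r2 (reach_weaken _ _ _ (C `|` (prox_arguments `|` new_primal)) _ reach_new_dual).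
have {}r3 := r3 ltac:(by move=> f [?|?]; [left|right; right]).
have r4 := reach_bind _ _ _ _ _ r3 (reach_weaken _ _ _ (C `|` (prox_arguments `|` new_primal `|` new_dual)) _ reach_residual).
have {}r4 := r4 ltac:(by move=> f [[?|?]|?]; [left|right; left; right|right; right]).
apply: (@le_trans _ _ ((G * (d * 5) + G * (kappa * d) + G * (d * 9 + 3)
    + (G * (d * 11 + 14) + 5))%:R%:E)); last first.
  by rewrite lee_fin ler_nat; nia.
apply: op_cost_le; apply: reach_sub r4.
move=> f [[c [[x [i ->]]|[x ->]] <-]|->]; last by right.
  by left; left; right; exists x, i.
by left; right; exists x.
Qed.

Lemma reach_average (S : {set grid d N}) (F : grid d N -> state -> R) :
  (forall y, C (F y)) ->
  reach (#|S|.+1) C [set fun z => average S (fun y => F y z)].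
Proof.
move=> CF; have -> : (fun z => average S (fun y => F y z)) =
    fun z => #|S|%:R^-1 * \sum_(y <- enum S) F y z.
  by apply/funext => z; rewrite mulrC big_enum.
apply: reach_scale; rewrite cardE -[size _]muln1.
by apply: reach_sum => y; apply: reach_mem; exact: CF.
Qed.

(** Each fine point receives d + 1 averages, each of at most 2^d values and one further
    multiplication. *)
Lemma interpolation_cost_le :
  (interpolation_cost d p kappa N
    <= ((d.+1 * (2 ^ d).+1) * #|{: grid d N.*2}|)%:R%:E)%E.
Proof.
rewrite mulnC mulSn mulnDr; apply: op_cost_le.
have rs (x : grid d N.*2) : reach (2 ^ d).+1 C [set fun z : state => (interpolate z).2 x].
  have -> : (fun z : state => (interpolate z).2 x)
      = fun z => average (neighbours x) (fun y => z.2 y).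
    by apply/funext => z; rewrite ffunE.
  apply: reach_le (reach_average _ _ (fun y => coordinates_s y)).
  by rewrite ltnS card_neighbours.
have rv (x : grid d N.*2) : reach (d * (2 ^ d).+1) C
    [set f | exists i, f = fun z : state => (interpolate z).1 x 0 i].
  rewrite -[X in reach (X * _)](card_ord d).
  apply: (reach_family _ _ _ (fun i => [set fun z : state => (interpolate z).1 x 0 i])) => i.
  have -> : (fun z : state => (interpolate z).1 x 0 i)
      = fun z => average (if odd (x i) then left_neighbours x i else neighbours x)
                   (fun y => z.1 y 0 i).
    by apply/funext => z; rewrite ffunE mxE.
  apply: reach_le (reach_average _ _ (fun y => coordinates_v y i)).
  rewrite ltnS; apply: leq_trans (card_neighbours x); case: ifP => // _.
  by apply: subset_leq_card; apply/fintype.subsetP => y; rewrite inE => /andP[].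
apply: reach_sub (reach_union _ _ _ _ _ (reach_family _ _ _ _ rs) (reach_family _ _ _ _ rv)).
move=> f [c [[x [i ->]]|[x ->]] <-]; first by right; exists x, i.
by left; exists x.
Qed.

End GridCost.

(** * Rates *)


Lemma cellsE n : cells n = (2 ^ n)%N.
Proof. by elim: n => //= n IH; rewrite /cells /= -/(cells n) IH expnS mul2n. Qed.

Lemma cells_gt0 n : (0 < cells n)%N.
Proof. by rewrite cellsE expn_gt0. Qed.

Lemma h_E {R : realType} n : h_ R n = 2 `^ (- n%:R).
Proof. by rewrite /h_ /step cellsE natrX powR_invn. Qed.

Lemma h_gt0 {R : realType} n : 0 < h_ R n.
Proof. by rewrite h_E powR_gt0. Qed.

Lemma card_grid_le d N : (0 < d)%N -> (0 < N)%N -> (#|{: grid d N}| <= 2 ^ d * N ^ d)%N.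
Proof.
by move=> d0 N0; rewrite card_ffun !card_ord -expnMn leq_exp2r// mul2n -addnn; lia.
Qed.

Section Complexity.
Context {R : realType} {d : nat} {p : \bar R} (kappa : nat).
Context (d_gt0 : (0 < d)%N) (p_ge1 : (1 <= p)%E).

(** The first factor comes from 3 ||A|| <= 6 sqrt d N, the second from the operations per grid point
    and N + 1 <= 2 N. *)
Definition level_const : R := 6 * Num.sqrt d%:R * ((kappa * d + 25 * d + 22) * 2 ^ d)%:R.

Lemma level_const_ge0 : 0 <= level_const.
Proof. by rewrite !mulr_ge0. Qed.

Lemma l2sqN N (z : state R d N) : l2sq (- z) = l2sq z.
Proof.
rewrite /l2sq /l2sq_v /l2sq_s; congr (_ + _); apply: eq_bigr => x _; congr (_ * _).
  by apply: eq_bigr => i _; rewrite !ffunE !mxE sqrrN.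
by rewrite !ffunE sqrrN.
Qed.

Lemma l2sq_ge0 N (z : state R d N) : (0 < N)%N -> 0 <= l2sq z.
Proof. by move=> N0; rewrite addr_ge0 ?l2sq_v_ge0 ?l2sq_s_ge0. Qed.

Lemma op_cost_ge0 (X : Type) (inp out : set (X -> R)) :
  (0 <= op_cost d p kappa inp out)%E.
Proof. by apply: le_ereal_inf_tmp => _ [n _ <-]; rewrite lee_fin. Qed.

Lemma alg1_niter_ge0 N (rho : sfield R d N) z0 eps : (0 <= alg1_niter p rho z0 eps)%E.
Proof. by apply: le_ereal_inf_tmp => _ [n _ <-]; rewrite lee_fin. Qed.

Lemma alg1_complexity_le n (rho : sfield R d (cells n)) z0 zs (B eps : R) :
  saddle_points p rho zs -> l2sq (z0 - zs) <= B -> 0 < eps ->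
  (alg1_complexity p kappa rho z0 eps
    <= (level_const * B * (h_ R n ^+ d.+1)^-1 / eps)%:E)%E.
Proof.
move=> zss zB eps0; have N0 := cells_gt0 n.
have B0 : 0 <= B by rewrite (le_trans _ zB)// l2sq_ge0.
apply: (@le_trans _ _ ((6 * Num.sqrt d%:R * (cells n)%:R * B / eps)%:E *
   ((kappa * d + 25 * d + 22) * (2 ^ d * cells n ^ d))%:R%:E)%E).
  apply: lee_pmul; [exact: alg1_niter_ge0|exact: op_cost_ge0| |].
    apply: le_trans (alg1_niter_le p N0 d_gt0 p_ge1 rho z0 zs eps zss eps0) _.
    rewrite lee_fin ler_pM2r ?invr_gt0// ler_pM ?mulr_ge0 ?Anorm_ge0 ?l2sq_ge0//.
    by have := @Anorm_le R d (cells n) N0; lra.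
  apply: le_trans (iteration_cost_le N0 d_gt0 p_ge1 rho) _.
  by rewrite lee_fin ler_nat leq_mul2l card_grid_le// orbT.
rewrite -EFinM lee_fin le_eqVlt; apply/orP; left; apply/eqP.
have -> : (h_ R n ^+ d.+1)^-1 = (cells n)%:R ^+ d.+1 by rewrite /h_ /step exprVn invrK.
rewrite /level_const !natrM natrX natrX exprS; field.
by rewrite gt_eqF.
Qed.

End Complexity.

(** * Starting points of Algorithm 1M *)

Section Levels.
Context {R : realType} {d : nat} {p : \bar R}.
Context (rho0 rho1 : d.-tuple R -> R).

Lemma alg1M_start_ext (e e' : seq R) n : (forall k, (k < n)%N -> e`_k = e'`_k) ->
  alg1M_start p rho0 rho1 e n = alg1M_start p rho0 rho1 e' n.
Proof.
elim: n => [//|n IH] ee' /=; rewrite ee'// IH// => k kn; apply: ee'.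
exact: ltn_trans kn _.
Qed.

(** The threshold speaks of a run whose tolerance list ends at level n. The run with the full list
    agrees with it there, since a start reads coarser tolerances only. *)
Lemma threshold1M_accurate (C2 r : R) M ebar eps n :
  threshold1M p rho0 rho1 C2 r M ebar -> T1M M ebar eps -> (n <= M)%N ->
  accurate p rho0 rho1 C2 r (alg1M_output p rho0 rho1 eps n).
Proof.
move=> thr [seps adm] nM.
have sz : size (take n eps) = n by rewrite size_takel// seps leqW.
have admn : admissible ebar (take n eps).
  move=> k; rewrite sz => kn; rewrite nth_take// take_takel ?(ltnW kn)//.
  by apply: adm; rewrite seps ltnS (leq_trans (ltnW kn)).
have : accurate p rho0 rho1 C2 r
    (alg1M_output p rho0 rho1 (rcons (take n eps) eps`_n) (size (take n eps))).
  apply: (proj2 (thr _ _ admn)); first by rewrite sz.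
  by apply: adm; rewrite seps ltnS.
rewrite sz; have nthE k : (k <= n)%N -> (rcons (take n eps) eps`_n)`_k = eps`_k.
  rewrite nth_rcons sz leq_eqVlt => /predU1P[->|kn]; first by rewrite ltnn eqxx.
  by rewrite kn nth_take.
rewrite /alg1M_output nthE// (alg1M_start_ext _ eps)// => k kn.
by rewrite nthE// ltnW.
Qed.

(* [`|C1|] covers the coarsest level; the other term is a multiple of
   [h_(n-1) ^ r = (2 h_n) ^ r], the accuracy of the output on the level [n-1]. *)
Lemma alg1M_start_accurate (C1 C2 r : R) M ebar eps n :
  (0 < d)%N -> 0 < C2 -> (n <= M)%N ->
  (forall n, (n <= M)%N -> bounded_saddle_points p rho0 rho1 C1 n) ->
  (forall n, (n < M)%N -> interpolation_accurate p rho0 rho1 C2 r n) ->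
  threshold1M p rho0 rho1 C2 r M ebar -> T1M M ebar eps ->
  exists2 zs, saddle_points p (rho_ rho0 rho1 n) zs &
    l2sq (alg1M_start p rho0 rho1 eps n - zs)
      <= (`|C1| + 2 * (3 ^+ d + 1) * C2 * 2 `^ r) * h_ R n `^ r.
Proof.
move=> d0 C20 nM bsp ia thr adm.
have c0 : 0 <= 2 * (3 ^+ d + 1) * C2 * 2 `^ r.
  by rewrite !mulr_ge0 ?powR_ge0 ?(ltW C20)// addr_ge0// exprn_ge0.
case: n nM => [|n] nM.
  have [zs0 bd] := bsp 0 (leq0n M).
  have [zs zss zs_sum] := saddle_centered p (cells_gt0 0) _ zs0.
  exists zs => //=; rewrite sub0r l2sqN (le_trans (bd _ zss zs_sum))//.
  rewrite h_E oppr0 powRr0 powR1 mulr1 (le_trans (ler_norm _))// lerDl//.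
have [zs zss outE] := threshold1M_accurate C2 r M ebar eps n thr adm (ltnW nM).
have [zs' zss' intE] := ia n nM zs zss; exists zs' => //.
(* The term 3^d is the previous output's error carried through the interpolation, the term 1 the
   error of interpolating the saddle point; 2 comes from splitting the square. *)
apply: (@le_trans _ _ (2 * (3 ^+ d + 1) * C2 * h_ R n `^ r)).
  rewrite /=; have := @l2sqB_le R d (cells n.+1)
    (interpolate (alg1M_output p rho0 rho1 eps n)) (interpolate zs) zs'.
  move=> /le_trans; apply; rewrite -interpolateB.
  have := l2sq_interpolate_le (alg1M_output p rho0 rho1 eps n - zs) (cells_gt0 n).
  have := ler_wpM2l (exprn_ge0 d (ler0n R 3)) outE.
  by move: intE; rewrite /=; lra.
rewrite [leRHS]mulrDl -[leLHS]add0r lerD ?mulr_ge0 ?powR_ge0//.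
rewrite -[leRHS]mulrA ler_wpM2l ?mulr_ge0 ?(ltW C20) ?addr_ge0 ?exprn_ge0//.
rewrite !h_E -!powRrM -powRD ?pnatr_eq0 ?implybT//.
by rewrite le_eqVlt; apply/orP; left; apply/eqP; congr (_ `^ _); rewrite -[n.+1%:R]natr1; ring.
Qed.

End Levels.

(** * Summation over the levels *)

Lemma geometric_sum_gt1 {R : realFieldType} (q : R) M : 1 < q ->
  \sum_(n < M.+1) q ^+ n <= q / (q - 1) * q ^+ M.
Proof.
move=> q1; have q10 : 0 < q - 1 by rewrite subr_gt0.
rewrite mulrAC -exprS ler_pdivlMr// mulrC -subrX1 gerBl//.
Qed.

Lemma geometric_sum_lt1 {R : realFieldType} (q : R) M : 0 <= q < 1 ->
  \sum_(n < M.+1) q ^+ n <= (1 - q)^-1.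
Proof.
move=> /andP[q0 q1]; have q10 : 0 < 1 - q by rewrite subr_gt0.
rewrite -[leRHS]mul1r ler_pdivlMr// mulrC.
by have := subrX1 q M.+1; have := exprn_ge0 M.+1 q0; lra.
Qed.

Lemma sum_pow2_le M d : (0 < d)%N ->
  (\sum_(n < M) (2 ^ n.+1) ^ d <= 2 * (2 ^ M) ^ d)%N.
Proof.
move=> d0; elim: M => [|M IH]; first by rewrite big_ord0.
rewrite big_ord_recr/= mul2n -addnn leq_add2r (leq_trans IH)//.
rewrite expnS expnMn leq_mul2r; apply/orP; right.
by rewrite -{1}(expn0 2) ltn_exp2l.
Qed.

Section Rates.
Context {R : realType}.

Lemma powR2_gt1 (x : R) : 0 < x -> 1 < 2 `^ x.
Proof. by move=> x0; rewrite /powR pnatr_eq0/= expR_gt1 mulr_gt0// ln_gt0// ltr1n. Qed.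

Lemma powR2_lt1 (x : R) : x < 0 -> 2 `^ x < 1.
Proof.
move=> x0; rewrite -[x]opprK powRN invf_lt1 ?powR_gt0//.
by rewrite powR2_gt1// oppr_gt0.
Qed.

(* The exponent [alpha + d + 1 - r] of the geometric progression decides which
   level dominates. *)
Lemma level_rateE (d n M : nat) (alpha r e : R) :
  h_ R n `^ r * (h_ R n ^+ d.+1)^-1 / (e * (h_ R n / h_ R M) `^ alpha)
  = e^-1 * h_ R M `^ alpha * (2 `^ (alpha + d%:R + 1 - r)) ^+ n.
Proof.
rewrite -!powR_mulrn ?(ltW (h_gt0 _)) ?powR_ge0// !h_E.
rewrite -(powRB (x := 2)) ?pnatr_eq0 ?implybT// -!powRrM invfM -!powRN.
rewrite mulrCA -mulrA; congr (_ * _).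
rewrite -!powRD ?pnatr_eq0 ?implybT//; congr (_ `^ _).
by rewrite -[d.+1%:R]natr1; ring.
Qed.

Lemma finest_rateE (d M : nat) (alpha r : R) :
  h_ R M `^ alpha * (2 `^ (alpha + d%:R + 1 - r)) ^+ M = (h_ R M `^ (d%:R + 1 - r))^-1.
Proof.
rewrite -powR_mulrn ?powR_ge0// !h_E -!powRrM -powRN -powRD ?pnatr_eq0 ?implybT//.
by congr (_ `^ _); ring.
Qed.

End Rates.

Lemma sum_interpolation_cost_le {R : realType} d (p : \bar R) kappa M : (0 < d)%N ->
  (\sum_(n < M) interpolation_cost d p kappa (cells n)
    <= (((d.+1 * (2 ^ d).+1) * 2 ^ d * 2)%:R / h_ R M ^+ d)%:E)%E.
Proof.
move=> d0; apply: (@le_trans _ _ (\sum_(n < M)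
    ((d.+1 * (2 ^ d).+1) * (2 ^ d * (2 ^ n.+1) ^ d))%:R%:E)%E).
  apply: lee_sum => n _; apply: le_trans (interpolation_cost_le) _.
  rewrite lee_fin ler_nat leq_mul2l; apply/orP; right.
  apply: leq_trans (card_grid_le d (cells n).*2 d0 _) _.
    by rewrite double_gt0 cells_gt0.
  by rewrite cellsE expnS mul2n.
rewrite sumEFin lee_fin -natr_sum -!big_distrr/=.
have -> : (h_ R M ^+ d)^-1 = ((2 ^ M) ^ d)%:R.
  by rewrite /h_ /step exprVn invrK cellsE [RHS]natrX.
rewrite -natrM ler_nat -!mulnA leq_mul2l; apply/orP; right.
by rewrite leq_mul2l; apply/orP; right; rewrite leq_mul2l; apply/orP; right; exact: sum_pow2_le.
Qed.

Theorem theorem4p3 (R : realType) (d : nat) (p : \bar R) (kappa : nat)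
    (C1 C2 r alpha : R) (hd : (0 < d)%N) (hp : (1 <= p)%E)
    (hC2 : 0 < C2) (hr : 0 < r) :
  exists C delta : R, [/\ 0 < C, 0 < delta &
  forall (rho0 rho1 : d.-tuple R -> R) (M : nat),
    let h := h_ R M in
    prob_density rho0 -> prob_density rho1 ->
    (forall n, (n <= M)%N -> bounded_saddle_points p rho0 rho1 C1 n) ->
    (forall n, (n < M)%N -> interpolation_accurate p rho0 rho1 C2 r n) ->
    h < delta ->
    (forall ebar eps : R,
       threshold1 p rho0 rho1 C2 r M ebar ->
       T1 ebar eps ->
       eps < delta ->
       (alg1_complexity p kappa (rho_ rho0 rho1 M) 0%R eps <=
         (C * (eps^-1 * (d%:R `^ (3 / 2) / h ^+ d.+1)))%:E)%E)
    /\
    (forall (ebar : seq R -> R) (eps : seq R),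
       threshold1M p rho0 rho1 C2 r M ebar ->
       T1M M ebar eps ->
       (forall n, (n <= M)%N -> eps`_n = eps`_M * (h_ R n / h) `^ alpha) ->
       (forall n, (n <= M)%N -> eps`_n < delta) ->
       let interp := d%:R * 2 ^+ d / h ^+ d in
       let complexity := alg1M_complexity p kappa rho0 rho1 M eps in
       [/\ r - d%:R - 1 < alpha ->
             (complexity <=
               (C * ((eps`_M)^-1 * (d%:R `^ (3 / 2) / h `^ (d%:R + 1 - r)))
                + C * interp)%:E)%E,
           alpha = r - d%:R - 1 ->
             (complexity <=
               (C * ((eps`_M)^-1 * (d%:R `^ (3 / 2) / h `^ (d%:R + 1 - r))
                     * ln h^-1)
                + C * interp)%:E)%E &
           alpha < r - d%:R - 1 ->
             (complexity <=
               (C * ((eps`_M)^-1 * (d%:R `^ (3 / 2) / h `^ (- alpha)))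
                + C * interp)%:E)%E])].
Proof.
pose q : R := 2 `^ (alpha + d%:R + 1 - r).
pose K1 : R := @level_const R d kappa.
pose K3 : R := `|C1| + 2 * (3 ^+ d + 1) * C2 * 2 `^ r.
pose K5 : R := ((d.+1 * (2 ^ d).+1) * 2 ^ d * 2)%:R.
(* One constant for the three regimes q > 1, q = 1 and q < 1. The absolute values keep the terms of
   the other regimes from lowering it. *)
pose Cs : R := `|q / (q - 1)| + 2 / ln 2 + `|(1 - q)^-1|.
have K10 : 0 <= K1 by exact: level_const_ge0.
have K30 : 0 <= K3.
  by rewrite addr_ge0// !mulr_ge0 ?powR_ge0 ?(ltW hC2)// addr_ge0// exprn_ge0.
have K50 : 0 <= K5 by [].
have ln2 : 0 < ln 2 :> R by rewrite ln_gt0// ltr1n.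
have Cs2 : 0 <= 2 / ln 2 :> R by rewrite divr_ge0// ltW.
have Cs0 : 0 <= Cs by rewrite !addr_ge0.
have Cs_gt1 : q / (q - 1) <= Cs.
  by rewrite (le_trans (ler_norm _))// /Cs -addrA lerDl addr_ge0.
have Cs_eq1 : 2 / ln 2 <= Cs by rewrite /Cs addrAC lerDr addr_ge0.
have Cs_lt1 : (1 - q)^-1 <= Cs.
  by rewrite (le_trans (ler_norm _))// /Cs lerDr addr_ge0.
clearbody Cs.
(* [C] is chosen after d and [K1] carries the dependence on d, so it is enough that the factor
   d^(3/2) of the rates is at least 1. *)
have D1 : 1 <= d%:R `^ (3 / 2) :> R.
  by rewrite -[leLHS](powRr0 d%:R) ler_powR ?ler1n// divr_ge0.
set D := d%:R `^ (3 / 2) in D1 *; clearbody D.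
(* The summands serve Algorithm 1, the iterations of Algorithm 1M and its interpolations; the 1
   makes [C] positive. *)
pose C := K1 * `|C1| + K1 * K3 * Cs + K5 + 1.
have CK1 : K1 * `|C1| <= C.
  by rewrite /C -!addrA lerDl !addr_ge0// !mulr_ge0.
have CK3 : K1 * K3 * Cs <= C.
  by rewrite /C -!addrA addrCA lerDl !addr_ge0// !mulr_ge0.
have CK5 : K5 <= C.
  by rewrite /C addrAC lerDr !addr_ge0// !mulr_ge0.
have C0 : 0 < C by rewrite ltr_wpDl// !addr_ge0// !mulr_ge0.
clearbody C.
exists C, 1; split=> // rho0 rho1 M h _ _ bsp ia h1.
have h0 : 0 < h by exact: h_gt0.
split=> [ebar eps _ /andP[eps0 _] _|ebar eps thr adm epsE _].
  have [zs0 bd] := bsp M (leqnn M).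
  have [zs zss zs_sum] := saddle_centered p (cells_gt0 M) _ zs0.
  have zsB : l2sq (0 - zs) <= `|C1|.
    by rewrite sub0r l2sqN (le_trans (bd _ zss zs_sum))// ler_norm.
  apply: le_trans (alg1_complexity_le kappa hd hp M _ 0 zs _ eps zss zsB eps0) _.
  rewrite lee_fin -/K1 -/h -mulrA.
  have E0 : 0 <= (h ^+ d.+1)^-1 / eps by rewrite divr_ge0 ?invr_ge0 ?exprn_ge0 ?ltW.
  have -> : C * (eps^-1 * (D / h ^+ d.+1)) = C * (D * ((h ^+ d.+1)^-1 / eps)) by ring.
  set E := _ / eps in E0 *; clearbody E.
  by rewrite ler_pM ?mulr_ge0// ler_peMl.
have eM0 : 0 < eps`_M.
  by case: adm => seps adm; have /andP[] := adm M (eq_leq (esym seps)).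
move=> interp complexity.
(* Common to the three cases, which differ only in the target X for the geometric sum. *)
have rate X : 0 <= X -> h `^ alpha * \sum_(n < M.+1) q ^+ n <= Cs * X ->
    (complexity <= (C * ((eps`_M)^-1 * (D * X)) + C * interp)%:E)%E.
  move=> X0 qX; rewrite /complexity /alg1M_complexity EFinD leeD//; last first.
    apply: le_trans (sum_interpolation_cost_le d p kappa M hd) _.
    rewrite lee_fin -/K5 -/h /interp.
    have H0 : 0 <= (h ^+ d)^-1 by rewrite invr_ge0 exprn_ge0// ltW.
    rewrite ler_pM// ler_peMl// -natrX -natrM ler1n muln_gt0 hd expn_gt0//.
  apply: (@le_trans _ _ (\sum_(n < M.+1)
      (K1 * K3 * ((eps`_M)^-1 * h `^ alpha * q ^+ n))%:E)%E).
    apply: lee_sum => n _; have nM : (n <= M)%N by rewrite -ltnS.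
    have [zs zss zsB] := alg1M_start_accurate _ _ C1 C2 r M ebar eps n hd hC2 nM bsp ia thr adm.
    have en0 : 0 < eps`_n.
      case: adm => seps adm; have nlt : (n < size eps)%N by rewrite seps.
      by have /andP[] := adm n nlt.
    apply: le_trans (alg1_complexity_le kappa hd hp n _ _ zs _ _ zss zsB en0) _.
    rewrite lee_fin -/K1 -/K3 epsE// -level_rateE -/h le_eqVlt; apply/orP; left.
    by rewrite !mulrA.
  rewrite sumEFin lee_fin -!mulr_sumr.
  apply: (@le_trans _ _ (K1 * K3 * ((eps`_M)^-1 * (Cs * X)))).
    by rewrite -[_ * h `^ alpha * _]mulrA !ler_wpM2l ?mulr_ge0 ?invr_ge0 ?(ltW eM0).
  have -> : K1 * K3 * ((eps`_M)^-1 * (Cs * X)) = (K1 * K3 * Cs) * ((eps`_M)^-1 * X) by ring.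
  rewrite ler_pM ?mulr_ge0 ?invr_ge0 ?(ltW eM0)//.
  by rewrite ler_wpM2l ?invr_ge0 ?(ltW eM0)// ler_peMl.
split=> halpha.
- apply: rate; first by rewrite invr_ge0 powR_ge0.
  have q1 : 1 < q by apply: powR2_gt1; lra.
  rewrite -(finest_rateE d M alpha r) -/q -/h mulrCA ler_wpM2l ?powR_ge0//.
  apply: le_trans (geometric_sum_gt1 q M q1) _.
  by rewrite ler_wpM2r// exprn_ge0// powR_ge0.
(* With a single level ln(1/h) would vanish. Here h < 1 gives M >= 1, so the M + 1 equal terms
   number at most 2 M = (2 / ln 2) ln(1/h). *)
- have M0 : (0 < M)%N.
    by rewrite lt0n; apply/eqP => M0; move: h1; rewrite /h h_E M0 oppr0 powRr0 ltxx.
  have hE : ln h^-1 = M%:R * ln 2 by rewrite /h h_E -powRN opprK ln_powR.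
  have hln : 0 <= ln h^-1 by rewrite hE mulr_ge0// ltW.
  rewrite -[_ * _ * ln _]mulrA -[D / _ * _]mulrA; apply: rate.
    by rewrite mulr_ge0// invr_ge0 powR_ge0.
  have q1 : q = 1 by rewrite /q -[RHS](powRr0 2); congr (_ `^ _); lra.
  rewrite -powRN [- _](_ : _ = alpha); last by lra.
  rewrite mulrCA ler_wpM2l ?powR_ge0// q1.
  under eq_bigr do rewrite expr1n.
  rewrite sumr_const card_ord hE (@le_trans _ _ (2 / ln 2 * (M%:R * ln 2)))//.
    have -> : 2 / ln 2 * (M%:R * ln 2) = 2 * M%:R :> R by field; rewrite gt_eqF.
    by rewrite -[M.+1%:R]natr1 mulr_natl mulr2n lerD2l ler1n.
  by rewrite ler_wpM2r// mulr_ge0// ltW.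
- apply: rate; first by rewrite invr_ge0 powR_ge0.
  have q1 : q < 1 by apply: powR2_lt1; lra.
  rewrite -powRN opprK mulrC ler_wpM2r ?powR_ge0//.
  apply: le_trans (geometric_sum_lt1 q M _) _; last exact: Cs_lt1.
  by rewrite powR_ge0.
Qed.
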